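(* Let $R(x)=g(x)/h(x)$ be a cubic rational expression, over a finite field $\mathbb{F}_q$ of characteristic two, with no ramification point having ramification index $3$. Then, for integers $n>1$, \[ |\mathcal{I}(g,h,n,q)|=\frac{q^n}{3n}+O\!\left(\frac{q^{n/2}}{n}\right). \]
   Context: A cubic rational expression over $\mathbb{F}_q$ is $R(x)=g(x)/h(x)$ with $g,h\in\mathbb{F}_q[x]$ coprime and $\max(\deg g,\deg h)=3$. The ramification points of $R$ (over the algebraic closure $\overline{\mathbb{F}}_q$) are the zeros in $\overline{\mathbb{F}}_q$ of the polynomial $g'(x)h(x)-g(x)h'(x)$, together with $\infty$ in case this polynomial has degree less than $4$. The ramification index of a point $P\in\mathbb{P}^1(\overline{\mathbb{F}}_q)$ is the multiplicity with which $R$, viewed as a map $\mathbb{P}^1\to\mathbb{P}^1$, takes the value $R(P)$ at $P$. For an integer $n>1$, $\mathcal{I}(g,h,n,q)$ denotes the set of monic irreducible polynomials $f\in\mathbb{F}_q[x]$ of degree $n$ such that $h(x)^n f\bigl(g(x)/h(x)\bigr)$ is irreducible in $\mathbb{F}_q[x]$. *)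

(* Defs.v *)
From HB Require Import structures.
From mathcomp Require Import all_boot all_order all_algebra all_field.
From mathcomp Require Import reals.

Set Implicit Arguments.
Unset Strict Implicit.
Unset Printing Implicit Defensive.

Import Order.TTheory GRing.Theory Num.Theory.
Local Open Scope ring_scope.

Definition degree (F : fieldType) (p : {poly F}) : nat := (size p).-1.

Definition rational_degree (F : fieldType) (g h : {poly F}) : nat :=
  maxn (degree g) (degree h).

Definition cubic_expression (F : fieldType) (g h : {poly F}) : Prop :=
  coprimep g h /\ rational_degree g h = 3%N.

Definition is_algebraic_closure (F : fieldType) (K : closedFieldType)
    (iota : {rmorphism F -> K}) : Prop :=
  forall z : K, algebraicOver iota z.

(* The projective line over K is [option K], with [None] the point at infinity.
   In what follows G and H are coprime. *)
Section ProjectiveLine.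
Variable K : fieldType.
Implicit Types (G H : {poly K}) (P c : option K).

(* With d the degree of G/H, the value at infinity is G`_d / H`_d. *)
Definition rational_value G H P : option K :=
  match P with
  | Some a => if H.[a] == 0 then None else Some (G.[a] / H.[a])
  | None => let d := rational_degree G H in
            if H`_d == 0 then None else Some (G`_d / H`_d)
  end.

(* The zeros of this polynomial are the finite points where G/H = c. *)
Definition fibre_poly G H c : {poly K} :=
  if c is Some a then G - a *: H else H.

(* A fibre has d points counted with multiplicity, d being the degree of G/H:
   the roots of [fibre_poly], and infinity as many times as the degree of
   [fibre_poly] falls short of d. *)
Definition value_multiplicity G H c P : nat :=
  let p := fibre_poly G H c in
  match P with
  | Some a => mup a p
  | None => (rational_degree G H - degree p)%N
  end.

Definition ramification_index G H P : nat :=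
  value_multiplicity G H (rational_value G H P) P.

(* The bound 4 = 2 * 3 - 2 is specific to G/H of degree 3.  The zero
   polynomial counts as having degree less than 4. *)
Definition cubic_ramification_point G H P : Prop :=
  let W := G^`() * H - G * H^`() in
  match P with
  | Some a => root W a
  | None => (size W <= 4)%N
  end.

End ProjectiveLine.

(* h ^ n * f (g / h), expanded; meaningful when f has degree at most n. *)
Definition cleared_subst (F : fieldType) (g h : {poly F}) (n : nat)
    (f : {poly F}) : {poly F} :=
  \sum_(i < n.+1) f`_i *: (g ^+ i * h ^+ (n - i)).

Lemma cleared_substE (F : fieldType) (g h : {poly F}) (n : nat)
    (f : {poly F}) :
    h != 0 -> (size f <= n.+1)%N ->
  tofrac (cleared_subst g h n f) =
    tofrac h ^+ n *
    (map_poly (fun a : F => tofrac a%:P) f).[tofrac g / tofrac h].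
Proof.
move=> h0 sf; have Hh : tofrac h != 0 by rewrite tofrac_eq0.
rewrite /cleared_subst rmorph_sum /=.
rewrite (@horner_coef_wide _ n.+1); last exact: leq_trans (size_poly _ _) sf.
rewrite mulr_sumr; apply: eq_bigr => i _.
rewrite coef_map_id0 ?polyC0 ?tofrac0 // -mul_polyC !rmorphM !rmorphXn /=.
have le_in : (i <= n)%N by rewrite -ltnS.
rewrite expr_div_n [RHS]mulrCA; congr (_ * _).
rewrite -[X in _ = _ ^+ X * _](subnK le_in) exprD mulrC -mulrA.
by congr (_ * _); rewrite mulrCA mulfV ?mulr1 // expf_neq0.
Qed.

(* A polynomial of degree n is an element of {poly_n.+1 F} (size at most n+1)
   of size n+1; [irreducibleb] decides [irreducible_poly]. *)
Definition transformed_irreducibles (F : finFieldType) (g h : {poly F})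
    (n : nat) : {set {poly_(n.+1) F}} :=
  [set f : {poly_(n.+1) F} |
    [&& (f : {poly F}) \is monic,
        size (f : {poly F}) == n.+1,
        irreducibleb (f : {poly F}) &
        irreducibleb (cleared_subst g h n (f : {poly F}))]].

(* Main.v *)
Require Import Defs.
From HB Require Import structures.
From mathcomp Require Import all_boot all_order all_algebra all_field.
From mathcomp Require Import reals ring lra zify.

(** Let [f] be monic irreducible of degree [n > 1] over [F], the field with [q]
elements, let [L] be the field with [Q = q ^ n] elements and [al] a root of [f]
in [L]. Over [L] the cleared substitution of [g / h] in [f] is the product of
the cubics [g - al' * h] over the conjugates [al'] of [al], and it is
irreducible over [F] exactly when the fibre of [g / h] above [al] has no point
in [L] ([irreducible_transformed]). Each such [f] has [n] roots, and the
elements of [L] in proper subfields number at most [2 * q ^ (n / 2)]. So it is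
enough to show that [Q / 3 + O(sqrt Q)] elements of [L] have an empty fibre
([card_empty_fibres]).

A fibre has [N <= 3] points, and for these values
[3 * (N == 0) + 3 * N = 3 + N * (N - 1) + (N == 2)]. Summing over all fibres,
[N] contributes [Q + O(1)] and [N == 2] contributes [O(1)], so what matters is
the number of pairs of distinct points with the same image. They are the points
of the curve

  [(g x * h y - g y * h x) / (x - y) = A x * y ^ 2 + B x * y + C x = 0]

with [A], [B], [C] of degree at most [2]. In characteristic two a value of [x]
with [A x] and [B x] nonzero carries two points or none according to the trace
of [A x * C x / B x ^ 2] over the prime field ([card_quadratic_roots]). It
remains to see that this trace vanishes for [Q / 2 + O(sqrt Q)] values of [x],
which is the Hasse-Weil bound, up to the constant, for a curve of genus at most
one.

That bound fails if the curve splits over an algebraic closure, and this is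
where ramification enters. Points of ramification index three are the common
zeros on the projective line of [B] and of the Wronskian
[W = A * X ^ 2 + B * X + C]; without them [B] is not zero and has a zero [t],
possibly at infinity, where [W] does not vanish. A splitting makes
[A * C / B ^ 2] of the form [z ^ 2 + z]; its expansion at [t] to first order,
together with the Pluecker relation between the minors of [g] and [h], makes
[A], [B] and [C] vanish together at the other zero of [B]. There the whole
cubic [g x * h - h x * g] is zero, against the coprimality of [g] and [h]
([corr_geometrically_nonsplit]).

The bound itself follows Stepanov and Bombieri ([stepanov_bound]). Factor [Q]
as [w * r] with [w = 2 ^ k] and [r = 2 ^ l] both close to [sqrt Q], and let
[T_j u] be the sum of the [u ^ (2 ^ i)] for [i < j]. With [u = A * C / B ^ 2]
and [V] the numerator of [T_k u], consider [G = a + b * V], where [a] and [b]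
are combinations of the [x ^ (i + j * w)] with [i < M] and [j < J]. At a point
[x] of [L] one has [x ^ Q = x] and, if the trace of [u x] is [eps], also
[T_k u ^ r = eps + T_l u]; hence [B x ^ (r - 1) * G x ^ r] is there the value
of a polynomial of degree about [r * M], which depends additively on [(a, b)].
There are more pairs [(a, b)] than such polynomials as soon as [J] slightly
exceeds [r / 2], so some nonzero pair gives the zero polynomial, and the
corresponding [G] vanishes at every [x] whose trace is [eps], while its degree
is [Q / 2 + O(sqrt Q)]. That [G] itself is not zero
([trace_numerator_independent]) is the geometric irreducibility of the curve
again: as [M < w / 2], the quadratic equation satisfied by [T_k u] may be read
with [x] and [x ^ w] as independent variables, and giving [x ^ w] a constant
value exhibits [u] as [z ^ 2 + z]. *)

Import Order.TTheory GRing.Theory Num.Theory.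
Local Open Scope ring_scope.
Set Implicit Arguments.
Unset Strict Implicit.
Unset Printing Implicit Defensive.

(** * Rings of characteristic two *)

(** The [ring] tactic does not know that [2 = 0]; given that equation as a
hypothesis it closes goals [x + y = 0] whose normal form has all coefficients
[2], hence this form of an equality. *)
Lemma pchar2_eq (R : nzRingType) (x y : R) : (2 \in [pchar R])%N -> x + y = 0
  -> x = y.
Proof. by move=> ch /eqP; rewrite addr_eq0 oppr_pchar2 // => /eqP. Qed.

Lemma pchar2_2 (R : nzRingType) : (2 \in [pchar R])%N -> 2%:R = 0 :> R.
Proof. by case/andP => _ /eqP. Qed.

Lemma addrr_pchar2 (R : comNzRingType) (x : R) : (2 \in [pchar R])%N -> x + x =
  0.
Proof. by move=> ch2; rewrite -mulr2n -mulr_natl pchar2_2 // mul0r. Qed.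

Lemma sqrrD_pchar2 (R : comNzRingType) (x y : R) : (2 \in [pchar R])%N ->
  (x + y) ^+ 2 = x ^+ 2 + y ^+ 2.
Proof. by move=> ch2; rewrite sqrrD -mulr_natl pchar2_2 // mul0r addr0. Qed.

Lemma exprD_pchar2 (R : comNzRingType) (x y : R) k : (2 \in [pchar R])%N ->
  (x + y) ^+ (2 ^ k) = x ^+ (2 ^ k) + y ^+ (2 ^ k).
Proof.
by move=> ch2; elim: k => // k IH; rewrite expnSr !exprM IH sqrrD_pchar2.
Qed.

Lemma expr_sum_pchar2 (R : comNzRingType) (I : finType) (f : I -> R) k :
  (2 \in [pchar R])%N -> (\sum_i f i) ^+ (2 ^ k) = \sum_i f i ^+ (2 ^ k).
Proof.
move=> ch2; apply: (big_morph (fun x => x ^+ (2 ^ k))).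
  by move=> x y; apply: exprD_pchar2.
by rewrite expr0n expn_eq0.
Qed.

Lemma closed_artin_schreier (K : closedFieldType) (c : K) :
  exists z, z ^+ 2 + z = c.
Proof.
pose p : {poly K} := 'X^2 + 'X - c%:P.
have /closed_rootP[z] : size p != 1.
  have p2 : p`_2 = 1 by rewrite !coefD coefN coefXn coefX coefC /= subr0 addr0.
  apply: contraTneq (oner_neq0 K) => sp.
  by rewrite -p2 nth_default ?sp // eqxx.
by rewrite rootE !hornerE subr_eq0 => /eqP; exists z.
Qed.

(** * Polynomials of small degree *)

Section Quadratics.
Variable F : fieldType.

Lemma size_quadratic (a b c : F) :
  (size (a%:P * 'X^2 + b%:P * 'X + c%:P : {poly F})%R <= 3)%N.
Proof.
apply: leq_trans (size_polyD _ _) _; rewrite geq_max.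
rewrite (leq_trans (size_polyC_leq1 c)) // andbT.
apply: leq_trans (size_polyD _ _) _; rewrite geq_max !mul_polyC.
rewrite (leq_trans (size_scale_leq _ _)) ?size_polyXn //.
by rewrite (leq_trans (size_scale_leq _ _)) ?size_polyX.
Qed.

Lemma coef_quadratic (a b c : F) (i : nat) :
  (a%:P * 'X^2 + b%:P * 'X + c%:P : {poly F})`_i = [:: c; b; a]`_i.
Proof.
rewrite !coefD !coefCM coefXn coefX coefC.
by case: i => [|[|[|i]]] /=; rewrite ?mulr1 ?mulr0 ?addr0 ?add0r ?nth_nil.
Qed.

Lemma horner_quadratic (a b c x : F) :
  (a%:P * 'X^2 + b%:P * 'X + c%:P).[x] = a * x ^+ 2 + b * x + c.
Proof. by rewrite !hornerE. Qed.

Lemma coef_quadratic_mul (a b c x y z : F) :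
  let q := (a%:P * 'X^2 + b%:P * 'X + c%:P) * (x%:P * 'X^2 + y%:P * 'X + z%:P)
    in
  q`_4 = a * x /\ q`_3 = a * y + b * x.
Proof.
rewrite /=; set q := _ * _.
have -> : q = (a * x)%:P * 'X^4 + (a * y + b * x)%:P * 'X^3 +
    ((a * z + b * y + c * x)%:P * 'X^2 + (b * z + c * y)%:P * 'X + (c * z)%:P).
  by rewrite /q !(rmorphD, rmorphM) /=; ring.
by rewrite !(coefD, coefMXn, coefMX, coefCM, coefXn, coefX, coefC) /=; split;
  ring.
Qed.

Lemma poly4E (f : {poly F}) : (size f <= 4)%N ->
  f = (f`_0)%:P + (f`_1)%:P * 'X + (f`_2)%:P * 'X^2 + (f`_3)%:P * 'X^3.
Proof.
move=> sf; apply/polyP=> i; rewrite !coefD !coefCM !coefXn coefX coefC.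
case: i => [|[|[|[|i]]]] /=; rewrite ?mulr1 ?mulr0 ?addr0 ?add0r //.
by rewrite nth_default // (leq_trans sf).
Qed.

End Quadratics.

Lemma size_mul_degree (R : nzSemiRingType) (p q : {poly R}) a b :
  (size p <= a.+1)%N -> (size q <= b.+1)%N -> (size (p * q)%R <= (a + b).+1)%N.
Proof.
move=> sp sq; apply: leq_trans (size_polyMleq _ _) _.
by rewrite -ltnS; move: sp sq; case: (size p) (size q) => [|x] [|y]; lia.
Qed.

Lemma size_exp_degree (R : nzSemiRingType) (p : {poly R}) a i :
  (size p <= a.+1)%N -> (size (p ^+ i)%R <= (a * i).+1)%N.
Proof.
move=> sp; elim: i => [|i IH]; first by rewrite expr0 size_poly1.
by rewrite exprS mulnS; apply: size_mul_degree.
Qed.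

Lemma coefM_top (R : nzSemiRingType) (p q : {poly R}) a b :
  (size p <= a.+1)%N -> (size q <= b.+1)%N -> (p * q)`_(a + b) = p`_a * q`_b.
Proof.
move=> sp sq; have ab : (a < (a + b).+1)%N by rewrite ltnS leq_addr.
rewrite coefM (bigD1 (Ordinal ab)) //= addKn big1 ?addr0 // => i.
rewrite -val_eqE /= => ia; have [ai|ia'] := ltnP a i.
  by rewrite nth_default ?mul0r // (leq_trans sp).
rewrite [q`_ _]nth_default ?mulr0 // (leq_trans sq) //.
by move: ia ia'; clear; lia.
Qed.

Lemma coefX_top (R : nzSemiRingType) (p : {poly R}) a i :
  (size p <= a.+1)%N -> (p ^+ i)`_(a * i) = p`_a ^+ i.
Proof.
move=> sp; elim: i => [|i IH]; first by rewrite muln0 !expr0 coef1.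
by rewrite exprS mulnS coefM_top ?IH -?exprS //; apply: size_exp_degree.
Qed.

Lemma card_roots_lt (F : finFieldType) (p : {poly F}) (S : {set F}) :
  p != 0 -> (forall x, x \in S -> root p x) -> (#|S| < size p)%N.
Proof.
move=> p0 pS; rewrite cardE; apply: max_poly_roots => //; last exact: enum_uniq.
by apply/allP => x; rewrite mem_enum; apply: pS.
Qed.

Lemma irreducible_no_root (F : fieldType) (f : {poly F}) (a : F) :
  irreducible_poly f -> (2 < size f)%N -> ~~ root f a.
Proof.
move=> irf sf; apply/negP; rewrite root_factor_theorem => /irf.
by rewrite size_XsubC => /(_ isT) /eqp_size; rewrite size_XsubC => E;
  rewrite -E in sf.
Qed.

(** * The curve of pairs of points with the same image *)

Lemma rational_degree_sizes (F : fieldType) (g h : {poly F}) :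
  rational_degree g h = 3%N -> (size g <= 4)%N /\ (size h <= 4)%N.
Proof.
rewrite /rational_degree /degree => d3;
  have := leq_maxl (size g).-1 (size h).-1.
have := leq_maxr (size g).-1 (size h).-1; rewrite {}d3.
by case: (size g) (size h) => [|?] [|?].
Qed.

Section Correspondence.
Variables (F : fieldType) (g h : {poly F}).

Definition pluecker (i j : nat) : F := g`_i * h`_j - g`_j * h`_i.

Local Notation p := pluecker.

(** The coefficients of [(x ^ i * y ^ j - x ^ j * y ^ i) / (x - y)], collected
by powers of [y], for [i > j] weighted with the minors [p i j]. *)
Definition corrA : {poly F} := (p 3 2)%:P * 'X^2 + (p 3 1)%:P * 'X + (p 3 0)%:P.

Definition corrB : {poly F} :=
  (p 3 1)%:P * 'X^2 + (p 3 0 + p 2 1)%:P * 'X + (p 2 0)%:P.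

Definition corrC : {poly F} := (p 3 0)%:P * 'X^2 + (p 2 0)%:P * 'X + (p 1 0)%:P.

(** The curve meets the diagonal at the zeros of this polynomial, which is the
Wronskian of [g] and [h]. *)
Definition corrW : {poly F} := corrA * 'X^2 + corrB * 'X + corrC.

Lemma size_corrA : (size corrA <= 3)%N. Proof. exact: size_quadratic. Qed.
Lemma size_corrB : (size corrB <= 3)%N. Proof. exact: size_quadratic. Qed.
Lemma size_corrC : (size corrC <= 3)%N. Proof. exact: size_quadratic. Qed.

Lemma horner_corrW (x : F) :
  corrW.[x] = corrA.[x] * x ^+ 2 + corrB.[x] * x + corrC.[x].
Proof.
have ev (P Q S : {poly F}) :
    (P * 'X^2 + Q * 'X + S).[x] = P.[x] * x ^+ 2 + Q.[x] * x + S.[x].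
  by rewrite !hornerE.
exact: ev.
Qed.

Lemma coef_corrW4 : corrW`_4 = p 3 2.
Proof.
have cf (P Q S : {poly F}) : (P * 'X^2 + Q * 'X + S)`_4 = P`_2 + Q`_3 + S`_4.
  by rewrite !coefD coefMXn coefMX.
by rewrite /corrW cf !coef_quadratic /= !addr0.
Qed.

(** The relation satisfied by the minors of every [2 x 4] matrix. A symmetric
equation of degree two in each variable comes from a map only if its
coefficients satisfy it, and it is needed to exclude a splitting. *)
Lemma pluecker_rel : p 3 2 * p 1 0 - p 3 1 * p 2 0 + p 3 0 * p 2 1 = 0.
Proof. by rewrite /p; ring. Qed.

Hypotheses (cgh : coprimep g h) (dgh : rational_degree g h = 3%N).

Let sg : (size g <= 4)%N. Proof. by case: (rational_degree_sizes dgh). Qed.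
Let sh : (size h <= 4)%N. Proof. by case: (rational_degree_sizes dgh). Qed.

(** As a polynomial in [y], the equation of the fibre through [x] is the factor
[x - y] times the equation of the curve. *)
Lemma corr_fibre (x : F) :
  g.[x] *: h - h.[x] *: g =
  (x%:P - 'X) * (corrA.[x] *: 'X^2 + corrB.[x] *: 'X + corrC.[x]%:P).
Proof.
rewrite [X in _ *: X - _](poly4E sh) [X in _ - _ *: X](poly4E sg).
rewrite [X in X.[_] *: _ - _](poly4E sg) [X in _ - X.[_] *: _](poly4E sh).
rewrite /corrA /corrB /corrC /p !hornerE -!mul_polyC.
rewrite !(rmorphD, rmorphB, rmorphM, rmorphXn) /=.
ring.
Qed.

Lemma corrP (x y : F) :
  g.[x] * h.[y] - g.[y] * h.[x] =
  (x - y) * (corrA.[x] * y ^+ 2 + corrB.[x] * y + corrC.[x]).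
Proof.
have /(congr1 (horner^~ y)) := corr_fibre x.
by rewrite !hornerE => <-; rewrite [g.[y] * _]mulrC.
Qed.

Lemma wronskian_corr : g^`() * h - g * h^`() = corrW.
Proof.
rewrite /corrW {1 2}(poly4E sg) {1 2}(poly4E sh) /corrA /corrB /corrC /p.
rewrite !(derivE, polyCD, polyCB, polyCM).
set X := 'X; ring.
Qed.

Lemma top_coefs_neq0 : (g`_3 != 0) || (h`_3 != 0).
Proof.
have lc (p : {poly F}) : (size p).-1 = 3%N -> p`_3 != 0.
  move=> sp; rewrite -sp -lead_coefE lead_coef_eq0 -size_poly_eq0.
  by move: sp; case: (size p).
move: dgh; rewrite /rational_degree /degree maxnE.
case: (leqP (size h).-1 (size g).-1) => hg.
  by rewrite (eqP hg) addn0 => /lc ->.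
by rewrite subnKC ?(ltnW hg) // => /lc ->; rewrite orbT.
Qed.

Lemma coprime_scale_eq (u v : F) : u *: h = v *: g -> u = 0 /\ v = 0.
Proof.
move: dgh; rewrite /rational_degree /degree => d3 E.
have const (a b : {poly F}) (s t : F) : coprimep a b -> s != 0 ->
    s *: a = t *: b -> (size b <= 1)%N.
  move=> cab s0 e; have : b %| a \/ t = 0.
    have [->|t0] := eqVneq t 0; [by right | left].
    by rewrite -(dvdpZr _ _ s0) e dvdpZr.
  case=> [ba|t0]; last first.
    move: e; rewrite t0 scale0r => /eqP; rewrite scaler_eq0 (negPf s0) /=.
    by move=> /eqP a0; move: cab; rewrite a0 coprime0p -size_poly_eq1 => /eqP->.
  move: cab; rewrite coprimep_sym => /coprimepP/(_ b (dvdpp b) ba).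
  by rewrite -size_poly_eq1 => /eqP->.
have [u0|u0] := eqVneq u 0; have [v0|v0] := eqVneq v 0 => //.
- exfalso; move: E => /eqP; rewrite u0 scale0r eq_sym scaler_eq0 (negPf v0) /=.
  move=> /eqP g0; move: cgh d3; rewrite g0 coprime0p -size_poly_eq1 => /eqP->.
  by rewrite size_poly0.
- exfalso; move: E => /eqP; rewrite v0 scale0r scaler_eq0 (negPf u0) /=.
  move=> /eqP h0; move: cgh d3; rewrite h0 coprimep0 -size_poly_eq1 => /eqP->.
  by rewrite size_poly0.
- exfalso; have sg1 : (size g <= 1)%N.
    by apply: const u0 E; rewrite coprimep_sym.
  have sh1 : (size h <= 1)%N by apply: const cgh v0 (esym E).
  by move: d3 sg1 sh1; case: (size g) (size h) => [|[|?]] [|[|?]].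
Qed.

Lemma coprime_no_common_root (x : F) : g.[x] = 0 -> h.[x] = 0 -> False.
Proof.
move=> /eqP gx /eqP hx; move/coprimep_root/(_ gx): cgh.
by rewrite (eqP hx) eqxx.
Qed.

(** At such an [x] the equation [g x * h - h x * g] of the fibre through [x]
would vanish identically, so [g] and [h] would be proportional. *)
Lemma corr_no_common_root (x : F) :
  corrA.[x] = 0 -> corrB.[x] = 0 -> corrC.[x] = 0 -> False.
Proof.
move=> Ax Bx Cx; have := corr_fibre x.
rewrite Ax Bx Cx !scale0r !addr0 mulr0 => /eqP; rewrite subr_eq0 => /eqP.
by case/coprime_scale_eq; apply: coprime_no_common_root.
Qed.

Lemma corrA_neq0 : corrA != 0.
Proof.
apply/negP=> /eqP A0.
have coefA i : [:: p 3 0; p 3 1; p 3 2]`_i = 0.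
  by rewrite -coef_quadratic -/corrA A0 coef0.
have : g`_3 *: h = h`_3 *: g.
  apply/polyP=> i; rewrite !coefZ; apply/eqP; rewrite -subr_eq0 [h`_3 * _]mulrC.
  rewrite -/(p 3 i); case: i => [|[|[|[|i]]]].
  - exact/eqP/(coefA 0).
  - exact/eqP/(coefA 1).
  - exact/eqP/(coefA 2).
  - by rewrite /p subrr.
  rewrite /p [g`_i.+4]nth_default; last exact: leq_trans sg _.
  by rewrite [h`_i.+4]nth_default ?mulr0 ?mul0r ?subrr // (leq_trans sh).
case/coprime_scale_eq => g3 h3.
by move: top_coefs_neq0; rewrite g3 h3 eqxx.
Qed.

End Correspondence.

Section MapCorrespondence.
Variables (F F' : fieldType) (iota : {rmorphism F -> F'}) (g h : {poly F}).

Lemma map_pluecker i j :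
  pluecker (map_poly iota g) (map_poly iota h) i j = iota (pluecker g h i j).
Proof. by rewrite /pluecker !coef_map rmorphB !rmorphM. Qed.

Lemma map_quadratic (a b c : F) :
  map_poly iota (a%:P * 'X^2 + b%:P * 'X + c%:P) =
  (iota a)%:P * 'X^2 + (iota b)%:P * 'X + (iota c)%:P.
Proof.
apply/polyP=> i; rewrite coef_map !coef_quadratic.
by case: i => [|[|[|i]]] //=; rewrite !nth_nil rmorph0.
Qed.

Lemma map_corrA :
  map_poly iota (corrA g h) = corrA (map_poly iota g) (map_poly iota h).
Proof. by rewrite /corrA map_quadratic !map_pluecker. Qed.

Lemma map_corrB :
  map_poly iota (corrB g h) = corrB (map_poly iota g) (map_poly iota h).
Proof. by rewrite /corrB map_quadratic [iota (pluecker g h 3 0 + _)]rmorphD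
  !map_pluecker. Qed.

Lemma map_corrC :
  map_poly iota (corrC g h) = corrC (map_poly iota g) (map_poly iota h).
Proof. by rewrite /corrC map_quadratic !map_pluecker. Qed.

Lemma map_corrW :
  map_poly iota (corrW g h) = corrW (map_poly iota g) (map_poly iota h).
Proof.
rewrite /corrW 2!rmorphD 2!rmorphM /= map_polyXn map_polyX.
by rewrite map_corrA map_corrB map_corrC.
Qed.

Lemma rational_degree_map :
  rational_degree (map_poly iota g) (map_poly iota h) = rational_degree g h.
Proof. by rewrite /rational_degree /degree !size_map_poly. Qed.

End MapCorrespondence.

(** * Ramification of index three *)

Section Ramification.
Variables (K : closedFieldType) (g h : {poly K}).
Hypotheses (ch2 : (2 \in [pchar K])%N).
Hypotheses (cgh : coprimep g h) (dgh : rational_degree g h = 3%N).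

Local Notation A := (corrA g h).
Local Notation B := (corrB g h).
Local Notation C := (corrC g h).
Local Notation p := (pluecker g h).

Hypothesis no_index3 : forall P : option K,
  cubic_ramification_point g h P -> ramification_index g h P <> 3%N.

Lemma mup_cube (x a : K) : a != 0 -> mup x (a *: ('X - x%:P) ^+ 3) = 3%N.
Proof.
by move=> a0; rewrite -mul_polyC mupMr ?rootC // mup_XsubCX eqxx.
Qed.

(** At a common zero [x] the curve has the equation [A x * (y ^ 2 + x ^ 2)], a
square in characteristic two, so the fibre through [x] is a triple point. *)
Lemma corrB_corrW_coprime : coprimep B (corrW g h).
Proof.
apply/negPn/negP => ncop.
have /closed_rootP[x] : size (gcdp B (corrW g h)) != 1%N by [].
rewrite root_gcd => /andP[/rootP Bx Wx].
have Wram : cubic_ramification_point g h (Some x).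
  by rewrite /cubic_ramification_point wronskian_corr.
apply: (no_index3 Wram).
have Cx : C.[x] = A.[x] * x ^+ 2.
  apply: pchar2_eq => //; move: Wx.
  by rewrite rootE horner_corrW Bx mul0r addr0 addrC => /eqP.
have Ax : A.[x] != 0.
  apply/negP => /eqP A0; apply: (corr_no_common_root cgh dgh A0 Bx).
  by rewrite Cx A0 mul0r.
have cube : g.[x] *: h - h.[x] *: g = - A.[x] *: ('X - x%:P) ^+ 3.
  rewrite (corr_fibre dgh) Bx scale0r addr0 Cx -!mul_polyC rmorphM rmorphXn /=.
  have h2 : 2%:R = 0 :> {poly K} by apply: pchar2_2; rewrite pchar_poly.
  have -> : ('X - x%:P) ^+ 3 = ('X - x%:P) * ('X^2 + x%:P ^+ 2 - 2%:R * ('X *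
    x%:P)).
    by ring.
  by rewrite h2 mul0r subr0 rmorphN /=; ring.
rewrite /ramification_index /value_multiplicity /rational_value.
have [hx|hx] := eqVneq h.[x] 0 => /=.
  have gx : g.[x] != 0 by apply/negP=> /eqP gx;
    exact: (coprime_no_common_root cgh gx hx).
  have -> : h = (- A.[x] / g.[x]) *: ('X - x%:P) ^+ 3.
    apply: (scalerI gx); rewrite scalerA mulrC divfK //.
    by rewrite -cube hx scale0r subr0.
  by rewrite mup_cube // mulf_neq0 ?oppr_eq0 ?invr_eq0.
have -> : g - (g.[x] / h.[x]) *: h = (A.[x] / h.[x]) *: ('X - x%:P) ^+ 3.
  apply: (scalerI hx); rewrite scalerBr !scalerA ![h.[x] * (_ / _)]mulrC !divfK
    //.
  by rewrite -[A.[x]]opprK scaleNr -cube opprB.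
by rewrite mup_cube // mulf_neq0 ?invr_eq0.
Qed.

(** The analogue at infinity of the coprimality of [B] and [W]: these minors
are the coefficients of [x ^ 4] in [W] and of [x ^ 2] in [B]. *)
Lemma unramified_infinity : (p 3 2 != 0) || (p 3 1 != 0).
Proof.
rewrite -negb_and; apply/negP => /andP[/eqP p32 /eqP p31].
have Wram : cubic_ramification_point g h None.
  rewrite /cubic_ramification_point wronskian_corr //.
  rewrite /corrW /corrA /corrB p32 p31 polyC0 !mul0r !add0r.
  rewrite (leq_trans (size_polyD _ _)) // geq_max; apply/andP; split;
    last first.
    exact: leq_trans (size_corrC _ _) _.
  rewrite (leq_trans (size_polyD _ _)) // geq_max; apply/andP; split.
    by rewrite mul_polyC (leq_trans (size_scale_leq _ _)) // size_polyXn.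
  apply: (@leq_trans 3) => //; apply: (@size_mul_degree _ _ _ 1 1);
    last by rewrite size_polyX.
  rewrite mul_polyC (leq_trans (size_polyD _ _)) // geq_max.
  rewrite (leq_trans (size_scale_leq _ _)) ?size_polyX //=.
  by rewrite (leq_trans (size_polyC_leq1 _)).
apply: (no_index3 Wram).
rewrite /ramification_index /value_multiplicity /rational_value dgh.
have const (q : {poly K}) : (size q <= 4)%N -> (forall i, (0 < i < 4)%N -> q`_i
  = 0) ->
    (3 - degree q = 3)%N.
  move=> sq q0; have : (size q <= 1)%N.
    apply/leq_sizeP => i i0; have [i4|i4] := ltnP i 4.
      by rewrite q0 // i0.
    by rewrite nth_default // (leq_trans sq).
  by rewrite /degree; case: (size q) => [|[|]].
have p3 i : (0 < i < 4)%N -> g`_3 * h`_i = g`_i * h`_3.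
  move=> /andP[i0 i4]; apply/eqP; rewrite -subr_eq0 -/(p 3 i).
  case: i i0 i4 => [|[|[|[|]]]] //= _ _; rewrite ?p31 ?p32 //.
  by rewrite /pluecker subrr.
have [h3|h3] := eqVneq h`_3 0 => /=.
  apply: const => [|i /p3 /eqP]; first by case: (rational_degree_sizes dgh).
  rewrite h3 mulr0 mulf_eq0.
  by have := top_coefs_neq0 dgh; rewrite h3 eqxx orbF => /negPf-> /eqP.
apply: const.
  have [sg sh] := rational_degree_sizes dgh.
  rewrite (leq_trans (size_polyD _ _)) // geq_max sg size_polyN.
  by rewrite (leq_trans (size_scale_leq _ _)).
by move=> i /p3 E; rewrite coefB coefZ mulrAC E mulfK // subrr.
Qed.

End Ramification.

(** * Geometric irreducibility *)

Section ScalarIdentities.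
Variables (K : fieldType) (ch2 : (2 \in [pchar K])%N).
Let h2 := pchar2_2 ch2.

(** Here [t] is a zero of [B] outside the zeros of [W], and the equation
between [d ^ 2 * (A * C)] and a square is what the first-order expansion at [t]
of [A * C = v ^ 2 + v * B] gives. Moving [t] to the origin replaces [c] by [A]
and [f] by [f1 = W t], and sends the other zero of [B] to [s = d / b]. With [s]
as a parameter the hypotheses become [f1 = s ^ 2 * A] and
[A = a * s ^ 2 + s * b], after which the three conclusions are identities. *)
Lemma common_root_finite (a b c d e f t : K) : b != 0 ->
  b * t ^+ 2 + d * t + e = 0 ->
  let A := a * t ^+ 2 + b * t + c in
  let C := c * t ^+ 2 + e * t + f in
  A * t ^+ 2 + C != 0 ->
  d ^+ 2 * (A * C) = (b * C + e * A) ^+ 2 ->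
  a * f + b * e + c * (c + d) = 0 ->
  let x := t + d / b in
  [/\ a * x ^+ 2 + b * x + c = 0, b * x ^+ 2 + d * x + e = 0
    & c * x ^+ 2 + e * x + f = 0].
Proof.
move=> b0 hB A C f10 hAC hP x; rewrite /x; move: (d / b) (divfK b0 d) => s ds.
pose f1 := A * t ^+ 2 + C; rewrite -/f1 in f10.
have ec : e = b * t ^+ 2 + d * t by apply: pchar2_eq => //; rewrite addrC.
have cc : c = A + a * t ^+ 2 + b * t by apply: pchar2_eq => //; rewrite /A;
  ring: h2.
have Cc : C = A * t ^+ 2 + f1 by apply: pchar2_eq => //; rewrite /f1; ring: h2.
have fc : f = f1 + a * t ^+ 4 + d * t ^+ 2.
  by apply: pchar2_eq => //; rewrite /f1 /C ec {1}cc; ring: h2.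
rewrite Cc in hAC; clearbody A f1; clear x C Cc hB; subst d e f c.
have e1 : b * (A * t ^+ 2 + f1) + (b * t ^+ 2 + s * b * t) * A
          = b * f1 + s * b * t * A by apply: pchar2_eq => //; ring: h2.
rewrite {}e1 in hAC.
have hA : f1 = s ^+ 2 * A.
  apply: (mulfI (mulf_neq0 (expf_neq0 2 b0) f10)).
  have -> : b ^+ 2 * f1 * f1 =
      (b * f1 + s * b * t * A) ^+ 2 + (s * b) ^+ 2 * (A ^+ 2 * t ^+ 2).
    by apply: pchar2_eq => //; ring: h2.
  by rewrite -hAC; apply: pchar2_eq => //; ring: h2.
have {}hP : A = a * s ^+ 2 + s * b.
  have A0 : A != 0 by apply: contraNneq f10 => A0; rewrite hA A0 mulr0.
  apply: (mulfI A0); apply: pchar2_eq => //; rewrite -hP hA.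
  by apply: pchar2_eq => //; ring: h2.
subst f1 A.
have -> : (t + s) ^+ 2 = t ^+ 2 + s ^+ 2 by apply: pchar2_eq => //; ring: h2.
split.
- ring: h2.
- ring: h2.
have -> : (b * t ^+ 2 + s * b * t) * (t + s) = b * t ^+ 3 + s ^+ 2 * b * t.
  by apply: pchar2_eq => //; ring: h2.
ring: h2.
Qed.

(** The same computation when [b = 0] and the zero of [B] at infinity is
used. *)
Lemma common_root_infinite (a c d e f : K) : a != 0 -> d != 0 ->
  d ^+ 2 * (a * c) = (a * e) ^+ 2 ->
  a * f + c * (c + d) = 0 ->
  let x := e / d in
  [/\ a * x ^+ 2 + c = 0, d * x + e = 0 & c * x ^+ 2 + e * x + f = 0].
Proof.
move=> a0 d0 h hP x; rewrite /x; move: (e / d) (divfK d0 e) => s es.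
clear x; subst e.
have cc : c = a * s ^+ 2.
  by apply: (mulfI (mulf_neq0 (expf_neq0 2 d0) a0)); rewrite -mulrA h; ring.
subst c.
have fc : f = a * s ^+ 4 + s ^+ 2 * d.
  by apply: (mulfI a0); apply: pchar2_eq => //; rewrite -hP; ring.
subst f; split; ring: h2.
Qed.

End ScalarIdentities.

(** The polynomial ring is integrally closed: the root [s * B / t] of the monic
equation [v ^ 2 + v * B = D] is a polynomial. *)
Lemma artin_schreier_integral (K : fieldType) (B D s t : {poly K}) : t != 0 ->
  s ^+ 2 * B ^+ 2 + s * t * B ^+ 2 = t ^+ 2 * D ->
  exists v, v ^+ 2 + v * B = D.
Proof.
move=> t0 E; pose d := gcdp (s * B) t.
have d0 : d != 0 by rewrite gcdp_eq0 negb_and t0 orbT.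
have [s' Es] : exists s', s * B = s' * d by apply/dvdpP/dvdp_gcdl.
have [t' Et] : exists t', t = t' * d by apply/dvdpP/dvdp_gcdr.
have cst : coprimep s' t'.
  have := coprimep_div_gcd (_ : (s * B != 0) || (t != 0)).
  rewrite t0 orbT => /(_ isT).
  by rewrite -/d Es mulpK //; rewrite [X in coprimep _ (X %/ _)]Et mulpK.
have E' : s' ^+ 2 + s' * t' * B = t' ^+ 2 * D.
  apply: (mulfI (expf_neq0 2 d0)).
  transitivity ((s' * d) ^+ 2 + (s' * d) * (t' * d) * B); first by ring.
  transitivity ((t' * d) ^+ 2 * D); last by ring.
  by rewrite -Es -Et -E; ring.
have : t' %| s' ^+ 2.
  have -> : s' ^+ 2 = t' * (t' * D - s' * B).
    by rewrite mulrBr [t' * (t' * D)]mulrA -[t' * t']/(t' ^+ 2) -E'; ring.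
  exact: dvdp_mulr.
have : coprimep t' (s' ^+ 2) by rewrite coprimep_expr // coprimep_sym.
move=> /coprimepP/(_ t' (dvdpp _)) /[apply]; rewrite -size_poly_eq1.
move=> /size_poly1P[c c0 t'c]; exists (c^-1 *: s').
apply: (mulfI (_ : c%:P ^+ 2 != 0)); first by rewrite expf_neq0 // polyC_eq0.
rewrite -t'c -E' t'c -mul_polyC.
have : c%:P * c^-1%:P = 1 :> {poly K} by rewrite -polyCM divff.
by move: (c^-1%:P) => c' cc'; transitivity ((c%:P * c') ^+ 2 * s' ^+ 2 + (c%:P
  * c') * c%:P * s' * B); [ring | rewrite cc'; ring].
Qed.

Section Geometric.
Variables (K : closedFieldType) (g h : {poly K}).
Hypotheses (ch2 : (2 \in [pchar K])%N).
Hypotheses (cgh : coprimep g h) (dgh : rational_degree g h = 3%N).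
Hypothesis cBW : coprimep (corrB g h) (corrW g h).
Hypothesis noinf : (pluecker g h 3 2 != 0) || (pluecker g h 3 1 != 0).

Local Notation A := (corrA g h).
Local Notation B := (corrB g h).
Local Notation C := (corrC g h).
Local Notation p := (pluecker g h).

Let h2 : 2%:R = 0 :> K := pchar2_2 ch2.

Let pluecker2 : p 3 2 * p 1 0 + p 3 1 * p 2 0 + p 3 0 * (p 3 0 + (p 3 0 + p 2
  1)) = 0.
Proof.
transitivity (p 3 2 * p 1 0 - p 3 1 * p 2 0 + p 3 0 * p 2 1 + 2%:R * (p 3 1 * p
  2 0 + p 3 0 ^+ 2)); first by ring.
by rewrite pluecker_rel h2 mul0r addr0.
Qed.

Let ABC_noroot x : A.[x] = 0 -> B.[x] = 0 -> C.[x] = 0 -> False.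
Proof. exact: (corr_no_common_root cgh dgh). Qed.

(** A polynomial [v] as below factors [A * (A y ^ 2 + B y + C)] as
[(A y + v) * (A y + v + B)], that is, splits the curve. *)
Lemma corr_not_artin_schreier (v : {poly K}) : v ^+ 2 + v * B <> A * C.
Proof.
move=> E; have [b0|b0] := eqVneq (p 3 1) 0; last first.
  have [t Bt] : exists t, B.[t] = 0.
    have /closed_rootP[t /rootP Bt] : size B != 1.
      have : B`_2 != 0 by rewrite coef_quadratic.
      by apply: contraNneq => sB; rewrite nth_default // sB.
    by exists t.
  have Wt : A.[t] * t ^+ 2 + C.[t] != 0.
    have := coprimep_root cBW (introT rootP Bt).
    by rewrite horner_corrW Bt mul0r addr0.
  have Bt' : p 3 1 * t ^+ 2 + (p 3 0 + p 2 1) * t + p 2 0 = 0.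
    by rewrite -Bt horner_quadratic.
  have At : A.[t] = p 3 2 * t ^+ 2 + p 3 1 * t + p 3 0.
    exact: horner_quadratic.
  have Ct : C.[t] = p 3 0 * t ^+ 2 + p 2 0 * t + p 1 0.
    exact: horner_quadratic.
  (* [v] is determined at [t] to first order, the derivative of a square being
  0. *)
  have E1 : v.[t] ^+ 2 = A.[t] * C.[t].
    have := congr1 (horner^~ t) E.
    by rewrite /= hornerD [X in _ + X]hornerM hornerM hornerM Bt mulr0 addr0.
  have E2 : v.[t] * (p 3 0 + p 2 1) = p 3 1 * C.[t] + p 2 0 * A.[t].
    have dq (x y z : K) :
        (deriv (x%:P * 'X^2 + y%:P * 'X + z%:P)).[t] = y.
      by rewrite !derivE !hornerE; apply: pchar2_eq => //; ring: h2.
    have dA : (A^`()).[t] = p 3 1 := dq _ _ _.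
    have dB : (B^`()).[t] = p 3 0 + p 2 1 := dq _ _ _.
    have dC : (C^`()).[t] = p 2 0 := dq _ _ _.
    have ev (P Q R S : {poly K}) : P * P + P * Q = R * S -> Q.[t] = 0 ->
        P.[t] * Q^`().[t] = R^`().[t] * S.[t] + R.[t] * S^`().[t].
      move=> /(congr1 (fun q => (deriv q).[t])) + Qt.
      rewrite derivD !derivM !(hornerD, hornerM) Qt => <-.
      by apply: pchar2_eq => //; ring: h2.
    by have := ev v B A C E Bt; rewrite dA dB dC => ->; ring.
  have E3 : (p 3 0 + p 2 1) ^+ 2 * (A.[t] * C.[t]) = (p 3 1 * C.[t] + p 2 0 *
    A.[t]) ^+ 2.
    by rewrite -E1 -E2; ring.
  rewrite At Ct in Wt E3.
  have [] := common_root_finite ch2 b0 Bt' Wt E3 pluecker2.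
  set x := _ + _ / _ => Ax Bx Cx.
  by apply: (ABC_noroot (x := x)); rewrite horner_quadratic.
have a0 : p 3 2 != 0 by move: noinf; rewrite b0 eqxx orbF.
(* At infinity the top coefficients play this role, so the degree of [v]
counts. *)
have sv : (size v <= 3)%N.
  rewrite leqNgt; apply/negP => sv.
  have sAC : (size (A * C)%R <= 5)%N.
    apply: leq_trans (size_polyMleq _ _) _.
    by have := size_corrA g h; have := size_corrC g h; lia.
  have svB : (size (v * B)%R <= size v + 2)%N.
    apply: leq_trans (size_polyMleq _ _) _.
    have := size_corrB g h; move: (size v) (size B) => m k k3.
    by clear -k3; lia.
  have v0 : v != 0 by apply: contraTneq sv => ->; rewrite size_poly0.
  have sv2 : size (v ^+ 2) = (size v + size v).-1 by rewrite expr2 size_mul.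
  suff : (size (v ^+ 2)%R <= maxn (size v + 2) 5)%N by rewrite sv2; lia.
  rewrite -[v ^+ 2](addrK (v * B)) E.
  rewrite (leq_trans (size_polyD _ _)) // size_polyN geq_max.
  by rewrite (leq_trans sAC) ?leq_maxr // (leq_trans svB) ?leq_maxl.
have Ev : v = (v`_2)%:P * 'X^2 + (v`_1)%:P * 'X + (v`_0)%:P.
  apply/polyP=> i; rewrite coef_quadratic; case: i => [|[|[|i]]] //=.
  by rewrite nth_nil nth_default // (leq_trans sv).
have [E4 E3] : v`_2 ^+ 2 = p 3 2 * p 3 0 /\
    v`_2 * (p 3 0 + p 2 1) = p 3 2 * p 2 0.
  have cM := coef_quadratic_mul.
  have E4 := congr1 (fun q : {poly K} => q`_4) E.
  have E3 := congr1 (fun q : {poly K} => q`_3) E.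
  rewrite /= Ev /corrA /corrB /corrC b0 expr2 !coefD !(cM _ _ _ _ _ _ _).1 in
    E4.
  rewrite /= Ev /corrA /corrB /corrC b0 expr2 !coefD !(cM _ _ _ _ _ _ _).2 in
    E3.
  split; first by rewrite -E4; ring.
  move: E3; rewrite mul0r !mulr0 !addr0 [v`_1 * v`_2]mulrC -mulr2n -mulr_natl.
  by rewrite h2 mul0r add0r.
have hP : p 3 2 * p 1 0 + p 3 0 * (p 3 0 + (p 3 0 + p 2 1)) = 0.
  by rewrite -pluecker2 b0 mul0r addr0.
have [d0|d0] := eqVneq (p 3 0 + p 2 1) 0.
  have e0 : p 2 0 = 0 by apply: (mulfI a0); rewrite -E3 d0 !mulr0.
  have B0 : B = 0 by rewrite /corrB b0 d0 e0 polyC0 !mul0r !addr0.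
  have := cBW; rewrite B0 coprime0p -size_poly_eq1 => /eqP sW.
  by move: a0; rewrite -(coef_corrW4 g h) nth_default ?eqxx // sW.
have [|x0 x1 x2] := common_root_infinite ch2 a0 d0 _ hP (e := p 2 0).
  by rewrite -E4 -E3; ring.
apply: (ABC_noroot (x := p 2 0 / (p 3 0 + p 2 1))).
- by rewrite horner_quadratic b0 mul0r addr0.
- by rewrite horner_quadratic b0 mul0r add0r.
- by rewrite horner_quadratic.
Qed.

(** With [t] as denominator this says that [A * C / B ^ 2] is not of the form
[z ^ 2 + z] with [z] a rational function over [K]. *)
Theorem corr_geometrically_nonsplit (s t : {poly K}) : t != 0 ->
  s ^+ 2 * B ^+ 2 + s * t * B ^+ 2 <> t ^+ 2 * (A * C).
Proof.
by move=> t0 /(artin_schreier_integral t0)[v]; apply: corr_not_artin_schreier.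
Qed.

End Geometric.

(** * Partial traces *)

(** The sum of the [u ^ (2 ^ i)] for [i < k]. For [k = m] this is the trace
over the prime field of an element of the field with [2 ^ m] elements. *)
Fixpoint partial_trace (R : nzRingType) (k : nat) (u : R) : R :=
  if k is k'.+1 then partial_trace k' u ^+ 2 + u else 0.

Lemma partial_traceD (R : comNzRingType) (u : R) k l : (2 \in [pchar R])%N ->
  partial_trace (k + l) u = partial_trace k u ^+ (2 ^ l) + partial_trace l u.
Proof.
move=> ch2; elim: l => [|l IH]; first by rewrite addn0 addr0.
by rewrite addnS /= IH sqrrD_pchar2 // -exprM -addrA -expnSr.
Qed.

Lemma partial_trace_sqrD (R : comNzRingType) (u : R) k : (2 \in [pchar R])%N ->
  partial_trace k u ^+ 2 + partial_trace k u = u ^+ (2 ^ k) + u.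
Proof.
move=> ch2; elim: k => [|k IH] /=.
  by rewrite expr0n addr0 expr1 addrr_pchar2.
have h2 := pchar2_2 ch2; rewrite expnSr exprM.
move: (partial_trace k u) (u ^+ _) IH => T X E.
have -> : T ^+ 2 + u = T + X.
  apply: pchar2_eq => //; transitivity (T ^+ 2 + T + (u + X)); first by ring.
  by rewrite E; ring: h2.
rewrite sqrrD_pchar2 //; transitivity (T ^+ 2 + T + (X ^+ 2 + X));
  first by ring.
by rewrite E; apply: pchar2_eq => //; ring: h2.
Qed.

Lemma partial_trace_of_sqrD (R : comNzRingType) (z : R) j : (2 \in [pchar R])%N
  ->
  partial_trace j (z ^+ 2 + z) = z ^+ (2 ^ j) + z.
Proof.
move=> chR; elim: j => [|j IH] /=; first by rewrite expr1 addrr_pchar2.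
rewrite IH sqrrD_pchar2 // -exprM -expnSr -addrA [z ^+ 2 + (_ + _)]addrA.
by rewrite addrr_pchar2 // add0r.
Qed.

Section FieldTrace.
Variables (L : finFieldType) (m : nat).
Hypotheses (ch2 : (2 \in [pchar L])%N) (cardL : #|L| = (2 ^ m)%N).

Lemma trace_eq0_or_eq1 (u : L) : (partial_trace m u == 0) || (partial_trace m u
  == 1).
Proof.
have := partial_trace_sqrD u m ch2.
rewrite -cardL expf_card addrr_pchar2 //; move: (partial_trace m u) => T /eqP.
have -> : T ^+ 2 + T = T * (T + 1) by ring.
by rewrite mulf_eq0 addr_eq0 oppr_pchar2.
Qed.

(** A solution [z] in an algebraic closure satisfies [z ^ #|L| = z + trace u],
so it is fixed by the Frobenius map of [L] when the trace is zero. *)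
Lemma artin_schreier_solvable (u : L) : partial_trace m u = 0 -> exists z, z ^+
  2 + z = u.
Proof.
have [K [iota _]] := countable_algebraic_closure L.
move=> Tu; have [z Ez] := closed_artin_schreier (iota u).
have chK : (2 \in [pchar K])%N by rewrite (fmorph_pchar iota).
have iT j : partial_trace j (iota u) = iota (partial_trace j u).
  by elim: j => [|j IH] /=; rewrite ?rmorph0 // rmorphD rmorphXn IH.
have zQ : z ^+ #|L| = z.
  by rewrite cardL; apply: pchar2_eq => //;
    rewrite -partial_trace_of_sqrD // Ez iT Tu rmorph0.
have : root (map_poly iota ('X^#|L| - 'X)) z.
  by rewrite rmorphB /= map_polyXn map_polyX rootE !hornerE zQ subrr.
rewrite finField_genPoly rmorph_prod /=.
rewrite (eq_bigr (fun a => 'X - (iota a)%:P)); last first.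
  by move=> a _; rewrite rmorphB /= map_polyX map_polyC.
rewrite -(big_map iota xpredT (fun a => 'X - a%:P)) root_prod_XsubC.
case/mapP => a _ za; exists a; apply: (fmorph_inj iota).
by rewrite rmorphD rmorphXn /= -za.
Qed.

Lemma card_quadratic_roots (a b c : L) : a != 0 -> b != 0 ->
  #|[set y | a * y ^+ 2 + b * y + c == 0]| =
    (2 * (partial_trace m (a * c / b ^+ 2) == 0)%R)%N.
Proof.
move=> a0 b0; have h2 := pchar2_2 ch2.
case: eqP => [/artin_schreier_solvable[z Ez]|Tn0]; last first.
  rewrite muln0; apply/eqP; rewrite cards_eq0; apply/set0Pn => -[y].
  rewrite inE => /eqP Ey; apply: Tn0.
  have -> : a * c / b ^+ 2 = (a * y / b) ^+ 2 + a * y / b.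
    have -> : c = a * y ^+ 2 + b * y by apply: pchar2_eq => //; rewrite addrC.
    by field.
  by rewrite partial_trace_of_sqrD // -cardL expf_card addrr_pchar2.
have Ec : c = b ^+ 2 / a * (z ^+ 2 + z) by rewrite Ez; field; rewrite ?a0 ?b0.
pose y0 := b / a * z.
have -> : [set y | a * y ^+ 2 + b * y + c == 0] = [set y0; y0 + b / a].
  apply/setP=> y; rewrite !inE -[y == y0]subr_eq0 -[y == y0 + _]subr_eq0.
  rewrite -mulf_eq0 -[RHS](mulrI_eq0 _ (mulfI a0)); congr (_ == _).
  apply: pchar2_eq => //; rewrite Ec /y0 !oppr_pchar2 //.
  transitivity (2%:R * (a * y ^+ 2 + b * y + b * y * z + b ^+ 2 / a * (z ^+ 2 +
    z))).
    by field.
  by rewrite h2 mul0r.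
by rewrite cards2 -[y0]addr0 -addrA (inj_eq (addrI _)) add0r eq_sym mulf_neq0
  ?invr_eq0.
Qed.

End FieldTrace.

(** The numerator of [partial_trace k (D / B ^ 2)] over the denominator
[B ^ (2 ^ k)]. *)
Fixpoint trace_numerator (R : nzRingType) (B D : {poly R}) (k : nat) : {poly R}
  :=
  if k is k'.+1 then trace_numerator B D k' ^+ 2 + B ^+ (2 ^ k - 2) * D else 0.

Lemma size_trace_numerator (R : idomainType) (B D : {poly R}) k :
  (size B <= 3)%N -> (size D <= 5)%N -> (size (trace_numerator B D k) <= (2 * 2
    ^ k).+1)%N.
Proof.
move=> sB sD; elim: k => [|k IH] /=; first by rewrite size_poly0.
have k0 : (0 < 2 ^ k)%N by rewrite expn_gt0.
rewrite (leq_trans (size_polyD _ _)) // geq_max; apply/andP; split.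
  rewrite expr2 (leq_trans (size_polyMleq _ _)) //.
  by move: IH k0; rewrite expnS; move: (size _) (2 ^ k)%N => a b; clear; lia.
rewrite (leq_trans (size_polyMleq _ _)) //.
have := @size_exp_degree _ _ 2 (2 ^ k.+1 - 2) sB; move: (size _) => a.
by move: sD k0; rewrite expnS; move: (size D) (2 ^ k)%N => b c; clear; lia.
Qed.

Lemma horner_trace_numerator (R : fieldType) (B D : {poly R}) k x :
  B.[x] != 0 ->
  (trace_numerator B D k).[x] = B.[x] ^+ (2 ^ k) * partial_trace k (D.[x] /
    B.[x] ^+ 2).
Proof.
move=> B0; elim: k => [|k IH] /=; first by rewrite horner0 mulr0.
rewrite hornerD horner_exp IH hornerM horner_exp mulrDr exprMn -exprM -expnSr.
congr (_ + _); rewrite -{2}[(2 ^ k.+1)%N](@subnK 2); last first.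
  by rewrite -{1}(expn1 2) leq_exp2l.
by rewrite exprD -mulrA; congr (_ * _); rewrite mulrC divfK ?expf_neq0.
Qed.

(** This is [partial_trace_sqrD] for [D / B ^ 2] with denominators cleared. The
factor [B ^ 2] keeps all exponents of [B] nonnegative. *)
Lemma trace_numerator_rel (R : idomainType) (B D : {poly R}) k :
  (2 \in [pchar R])%N -> B != 0 ->
  B ^+ 2 * trace_numerator B D k ^+ 2 + B ^+ 2 * B ^+ (2 ^ k) * trace_numerator
    B D k =
  B ^+ 2 * D ^+ (2 ^ k) + (B ^+ (2 ^ k)) ^+ 2 * D.
Proof.
move=> ch2R B0; have ch2 : (2 \in [pchar {poly R}])%N by rewrite pchar_poly.
have hB n : B ^+ 2 * B ^+ (2 ^ n.+1 - 2) = (B ^+ (2 ^ n)) ^+ 2.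
  by rewrite -exprD -exprM -expnSr subnKC // -{1}(expn1 2) leq_exp2l.
elim: k => [|k IH] /=.
  by rewrite expr0n !mulr0 addr0 expr1 addrr_pchar2.
have h2 := pchar2_2 ch2; have {hB} := hB k; rewrite expnSr !exprM.
move: (trace_numerator B D k) (B ^+ (2 ^ k)) (D ^+ (2 ^ k)) (B ^+ (2 ^ k * 2 -
  2)) IH.
move=> V b d e.
move=> IH hB.
have step : V ^+ 2 + e * D = b * V + d.
  apply: (mulfI (expf_neq0 2 B0)); apply: pchar2_eq => //.
  transitivity (B ^+ 2 * V ^+ 2 + B ^+ 2 * b * V + (B ^+ 2 * d + B ^+ 2 * e *
    D)).
    by ring.
  by rewrite IH hB; ring: h2.
rewrite {1}step sqrrD_pchar2 //.
transitivity (b ^+ 2 * (B ^+ 2 * V ^+ 2 + B ^+ 2 * V ^+ 2) + B ^+ 2 * d ^+ 2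
   + b ^+ 2 * (B ^+ 2 * e) * D); first by ring.
by rewrite addrr_pchar2 // hB; ring.
Qed.

(** * Separating a variable from its high powers *)

(** Substitution of [(x, x ^ n)] for the two variables of [P], the outer one
being [x]. *)
Definition collapse (R : comNzRingType) (n : nat) (P : {poly {poly R}}) : {poly
  R} :=
  (map_poly (comp_poly 'X^n) P).['X].

Section Collapse.
Variables (R : comNzRingType) (n : nat).
Implicit Types (P Q : {poly {poly R}}).

Lemma collapseD P Q : collapse n (P + Q) = collapse n P + collapse n Q.
Proof. by rewrite /collapse rmorphD hornerD. Qed.

Lemma collapseM P Q : collapse n (P * Q) = collapse n P * collapse n Q.
Proof. by rewrite /collapse rmorphM hornerM. Qed.

Lemma collapseC (q : {poly R}) : collapse n q%:P = q \Po 'X^n.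
Proof. by rewrite /collapse map_polyC hornerC. Qed.

Lemma collapse_map_polyC (q : {poly R}) : collapse n (q ^:P) = q.
Proof.
rewrite /collapse -map_poly_comp (eq_map_poly (g := polyC)) => [|x /=].
  by rewrite -/('X : {poly R}) -[RHS]comp_polyXr.
by rewrite comp_polyC.
Qed.

(** Euclidean division of exponents by [n]: below outer degree [n] no two
monomials of [P] collide. *)
Lemma coef_collapse P i j : (size P <= n)%N -> (i < n)%N ->
  (collapse n P)`_(i + j * n) = P`_i`_j.
Proof.
move=> sP ilt; have n0 : (0 < n)%N by apply: leq_ltn_trans ilt.
rewrite /collapse (horner_coef_wide _ (leq_trans (size_poly _ _) sP)) coef_sum.
rewrite (bigD1 (Ordinal ilt)) //= big1 ?addr0 => [|k].
  rewrite coefMXn ltnNge leq_addr /= addKn coef_map /= coef_comp_poly_Xn //.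
  by rewrite dvdn_mull // mulnK.
rewrite -val_eqE /= => kNi; rewrite coefMXn; case: ltnP => // le_k.
rewrite coef_map /= coef_comp_poly_Xn //; case: ifP => // /dvdnP[c Ec].
case/negP: kNi; apply/eqP; have : (i + j * n = k + c * n)%N by lia.
by move/(congr1 (modn^~ n)); rewrite ![(_ + _ * n)%N]addnC !modnMDl !modn_small.
Qed.

Lemma collapse_inj0 P : (size P <= n)%N -> collapse n P = 0 -> P = 0.
Proof.
move=> sP P0; apply/polyP=> i; apply/polyP=> j; rewrite !coef0.
have [ilt|nle] := ltnP i n; first by rewrite -coef_collapse // P0 coef0.
by rewrite [P`_i]nth_default ?coef0 // (leq_trans sP).
Qed.

Lemma size_collapse P m d : (size P <= m)%N ->
  (forall i, (size (P`_i)%R <= d)%N) ->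
  (size (collapse n P) <= m.-1 + d.-1 * n + 1)%N.
Proof.
move=> sP sc; rewrite /collapse (horner_coef_wide _ (leq_trans (size_poly _ _)
  sP)).
apply: (leq_trans (size_sum _ _ _)); apply/bigmax_leqP => i _.
apply: leq_trans (size_polyMleq _ _) _.
rewrite size_polyXn coef_map /= addnS /=.
move: (nat_of_ord i) (ltn_ord i) => {i} i ltim.
have := size_comp_poly_leq P`_i ('X^n); rewrite size_polyXn /= => sPi.
have : ((size (P`_i)%R).-1 * n <= d.-1 * n)%N.
  by rewrite leq_mul2r -!subn1 leq_sub2r ?orbT.
move: sPi ltim; move: (size (P`_i \Po 'X^n)) ((size (P`_i)%R).-1 * n)%N (d.-1 *
  n)%N => a b c.
clear; lia.
Qed.

End Collapse.

Lemma frobenius_comp (R : comNzRingType) (B : {poly R}) k : (2 \in [pchar R])%N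
  ->
  exists b, B ^+ (2 ^ k) = b \Po 'X^(2 ^ k).
Proof.
move=> ch2; elim/poly_ind: B => [|B c [b Eb]].
  by exists 0; rewrite comp_poly0 expr0n expn_eq0.
exists (b * 'X + (c ^+ (2 ^ k))%:P).
rewrite exprD_pchar2 ?pchar_poly // exprMn Eb comp_polyD comp_polyM comp_polyX.
by rewrite comp_polyC polyC_exp.
Qed.

Section Independence.
Variables (L : fieldType) (K : closedFieldType) (iota : {rmorphism L -> K}).
Hypothesis ch2 : (2 \in [pchar L])%N.
Variables (B D : {poly L}) (k m : nat).
Hypotheses (B0 : B != 0) (sB : (size B <= 3)%N) (sD : (size D <= 5)%N).
Hypothesis km : (2 * m + 3 <= 2 ^ k)%N.
Hypothesis nonsplit : forall s t : {poly K}, t != 0 ->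
  s ^+ 2 * map_poly iota B ^+ 2 + s * t * map_poly iota B ^+ 2
    <> t ^+ 2 * map_poly iota D.

Definition specialize (y : K) : {rmorphism {poly {poly L}} -> {poly K}} :=
  map_poly (horner_eval y \o map_poly iota).

Lemma specialize_polyC y (q : {poly L}) : specialize y q%:P = ((map_poly iota
  q).[y])%:P.
Proof. by rewrite /specialize /= map_polyC. Qed.

Lemma specialize_map_polyC y (q : {poly L}) : specialize y (q ^:P) = map_poly
  iota q.
Proof.
rewrite /specialize /= -map_poly_comp; apply: eq_map_poly => x /=.
by rewrite map_polyC /= /horner_eval hornerC.
Qed.

Let n := (2 ^ k)%N.
Let chP : (2 \in [pchar {poly L}])%N. Proof. by rewrite pchar_poly. Qed.
Let chK : (2 \in [pchar K])%N. Proof. by rewrite (fmorph_pchar iota). Qed.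

Lemma size_poly_lift (q : {poly L}) : size (q ^:P) = size q.
Proof. by rewrite size_map_inj_poly // ?polyC0 //; exact: polyC_inj. Qed.

(** If [Q] were nonzero, [a / (b * B ^ n)] with [a], [b] the collapses of [P],
[Q] would be a root [z] of [z ^ 2 + z = u + u ^ n] for [u = D / B ^ 2]. By the
bound on [m] the cleared equation has degree less than [n] in [x], so it still
holds when [x ^ n] is replaced by a constant [y]; then [u ^ n] becomes a
constant, which is itself of the form [e ^ 2 + e]. *)
Lemma trace_numerator_independent (P Q : {poly {poly L}}) :
  (size P <= m)%N -> (size Q <= m)%N ->
  collapse n P + collapse n Q * trace_numerator B D k = 0 -> P = 0 /\ Q = 0.
Proof.
move=> sP sQ E.
have [Q0|Q0] := eqVneq Q 0.
  split=> //; apply: (@collapse_inj0 _ n); last first.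
    by rewrite -E Q0 /collapse rmorph0 horner0 mul0r addr0.
  by apply: leq_trans (leq_trans sP _) km; lia.
have [b Eb] := frobenius_comp B k ch2; have [d Ed] := frobenius_comp D k ch2.
rewrite -/n in Eb Ed.
have Ea : collapse n P = collapse n Q * trace_numerator B D k
  by apply: pchar2_eq.
pose T := (B ^:P) ^+ 2 * P ^+ 2 + (B ^:P) ^+ 2 * b%:P * P * Q +
  Q ^+ 2 * ((B ^:P) ^+ 2 * d%:P + b%:P ^+ 2 * D ^:P).
have T0 : T = 0.
  apply: (@collapse_inj0 _ n).
    have sB' : (size (B ^:P) <= 2.+1)%N by rewrite size_poly_lift.
    have sD' : (size (D ^:P) <= 4.+1)%N by rewrite size_poly_lift.
    have [m' Em] : exists m', m = m'.+1.
      have m0 : (0 < m)%N by apply: leq_trans sQ; rewrite lt0n size_poly_eq0.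
      by exists m.-1; rewrite prednK.
    have sC (c : {poly L}) : (size c%:P%R <= 0.+1)%N by apply: size_polyC_leq1.
    rewrite Em in sP sQ.
    have sB2 := size_mul_degree sB' sB'.
    apply: (@leq_trans (2 * m + 3)%N _ _ _ km).
    have -> : (2 * m + 3 = (m' + m' + 4).+1)%N by rewrite Em; lia.
    rewrite /T !expr2; apply: leq_trans (size_polyD _ _) _.
    rewrite geq_max; apply/andP; split.
      apply: leq_trans (size_polyD _ _) _.
      rewrite geq_max; apply/andP; split.
        by apply: leq_trans (size_mul_degree sB2 (size_mul_degree sP sP)) _;
          lia.
      apply: leq_trans
        (size_mul_degree (size_mul_degree (size_mul_degree sB2 (sC b)) sP) sQ)
          _.
      by lia.
    apply: size_mul_degree; first exact: size_mul_degree.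
    apply: leq_trans (size_polyD _ _) _; rewrite geq_max; apply/andP; split.
      by have := size_mul_degree sB2 (sC d).
    by have := size_mul_degree (size_mul_degree (sC b) (sC b)) sD'.
  rewrite /T !(collapseD, collapseM, expr2, collapseC, collapse_map_polyC).
  rewrite -Eb -Ed -/n.
  have := trace_numerator_rel D k ch2 B0; rewrite -/n Ea.
  move: (collapse n Q) (trace_numerator B D k) (B ^+ n) (D ^+ n) => c V bb dd
    rel.
  have h2 := pchar2_2 chP.
  transitivity (c ^+ 2 * (B ^+ 2 * V ^+ 2 + B ^+ 2 * bb * V + (B ^+ 2 * dd + bb
    ^+ 2 * D))); first by ring.
  by rewrite rel addrr_pchar2 // mulr0.
have [i Qi] : exists i, Q`_i != 0.
  by exists (size Q).-1; rewrite -/(lead_coef Q) lead_coef_eq0.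
have b0 : b != 0.
  by apply: contraTneq (expf_neq0 n B0) => b0; rewrite Eb b0 comp_poly0 eqxx.
have /closed_nonrootP[y] : map_poly iota (b * Q`_i) != 0.
  by rewrite map_poly_eq0 mulf_neq0.
rewrite rmorphM rootE hornerM mulf_eq0 negb_or => /andP[by0 Qy0].
have /(congr1 (specialize y)) := T0.
rewrite rmorph0 /T 2!rmorphD !rmorphM rmorphD !rmorphM.
rewrite !specialize_map_polyC !specialize_polyC.
have : specialize y Q != 0.
  apply: contraNneq Qy0 => /(congr1 (fun q : {poly K} => q`_i)).
  by rewrite coef0 /specialize coef_map => /eqP.
move: (specialize y P) (specialize y Q) => s t t0.
move: (map_poly iota b).[y] (map_poly iota d).[y] by0 => bb dd b0' rel.
have [e Ee] : exists e : K, e ^+ 2 + e = dd / bb ^+ 2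
  by exact: closed_artin_schreier.
have hd : dd = bb ^+ 2 * (e ^+ 2 + e) by rewrite Ee mulrC divfK // expf_neq0.
exfalso; apply: (nonsplit (s := s + (e * bb)%:P * t) (t := bb%:P * t)).
  by rewrite mulf_neq0 // polyC_eq0.
have h2 : 2%:R = 0 :> {poly K} by apply: pchar2_2; rewrite pchar_poly.
have chKP : (2 \in [pchar {poly K}])%N by rewrite pchar_poly.
apply: pchar2_eq => //; rewrite -[RHS]rel hd sqrrD_pchar2 //.
rewrite !(rmorphM, rmorphD, rmorphXn) /=.
ring: h2.
Qed.

End Independence.

(** * Stepanov's method *)

Section OrdPoly.
Variables (R : nzRingType) (n : nat).

Definition ordpoly (c : 'I_n -> R) : {poly R} := \sum_i (c i)%:P * 'X^i.

Lemma coef_ordpoly c (i : 'I_n) : (ordpoly c)`_i = c i.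
Proof.
rewrite /ordpoly coef_sum (bigD1 i) //= big1 ?addr0 => [|j ji].
  by rewrite coefCM coefXn eqxx mulr1.
by rewrite coefCM coefXn [_ == _]eq_sym -[_ == _]/(j == i) (negPf ji) mulr0.
Qed.

Lemma size_ordpoly c : (size (ordpoly c) <= n)%N.
Proof.
apply: (leq_trans (size_sum _ _ _)); apply/bigmax_leqP => i _.
by rewrite mul_polyC (leq_trans (size_scale_leq _ _)) // size_polyXn ltn_ord.
Qed.

End OrdPoly.

Definition trace_set (L : finFieldType) (B D : {poly L}) (m : nat) (eps : L) :
    {set L} :=
  [set x | (B.[x] != 0) && (partial_trace m (D.[x] / B.[x] ^+ 2) == eps)].

Section Stepanov.
Variables (L : finFieldType) (K : closedFieldType) (iota : {rmorphism L -> K}).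
Hypothesis ch2 : (2 \in [pchar L])%N.
Variables (B D : {poly L}) (k l : nat).
Hypotheses (B0 : B != 0) (sB : (size B <= 3)%N) (sD : (size D <= 5)%N).
Hypothesis nonsplit : forall s t : {poly K}, t != 0 ->
  s ^+ 2 * map_poly iota B ^+ 2 + s * t * map_poly iota B ^+ 2
    <> t ^+ 2 * map_poly iota D.
Hypothesis cardL : #|L| = (2 ^ (k + l))%N.

Let n := (2 ^ k)%N.
Let r := (2 ^ l)%N.

Section Auxiliary.
Variables (M J : nat) (eps : L).

Definition bipoly (al : 'M[L]_(M, J)) : {poly {poly L}} :=
  ordpoly (fun i => ordpoly (fun j => al i j)).

(** The polynomial which agrees on [L] with the [r]-th power of the collapse of
[bipoly al], since [x ^ (j * n * r) = x ^ j] there. *)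
Definition spread (al : 'M[L]_(M, J)) : {poly L} :=
  \sum_i \sum_j (al i j ^+ r)%:P * 'X^(r * i + j).

(** [B ^ r * (eps + partial_trace l u)] for [u = D / B ^ 2]. *)
Definition twist : {poly L} := eps%:P * B ^+ r + trace_numerator B D l.

(** [B ^ (r - 1)] times the [r]-th power of the auxiliary polynomial, as it
looks at the points of [L] where the trace is [eps]. *)
Definition constraint (x : 'M[L]_(M, J) * 'M[L]_(M, J)) : {poly L} :=
  spread x.1 * B ^+ (r - 1) + spread x.2 * twist.

Lemma bipoly_eq0 al : bipoly al = 0 -> al = 0.
Proof.
move=> E; apply/matrixP=> i j; have := coef_ordpoly (fun j => al i j) j.
by rewrite -(coef_ordpoly (fun i => ordpoly (fun j => al i j))) -/(bipoly al) E
  !coef0 mxE.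
Qed.

Lemma spreadD al be : spread (al + be) = spread al + spread be.
Proof.
rewrite /spread -big_split; apply: eq_bigr => i _; rewrite -big_split.
by apply: eq_bigr => j _; rewrite mxE exprD_pchar2 // polyCD mulrDl.
Qed.

Lemma horner_collapse_bipoly al x :
  (collapse n (bipoly al)).[x] ^+ r = (spread al).[x].
Proof.
have Fx := expf_card x; rewrite cardL expnD in Fx.
rewrite /collapse /bipoly /spread /ordpoly rmorph_sum !horner_sum.
rewrite expr_sum_pchar2 //; apply: eq_bigr => i _.
rewrite rmorphM /= map_polyC /= map_polyXn !hornerE exprMn horner_sum.
rewrite rmorph_sum horner_sum expr_sum_pchar2 // mulr_suml;
  apply: eq_bigr => j _.
rewrite /= comp_polyM comp_polyC rmorphXn /= comp_polyX !hornerE exprMn -mulrA.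
congr (_ * _); rewrite exprD mulrC -!exprM mulnC; congr (_ * _).
by rewrite mulnAC exprM Fx.
Qed.

Lemma size_spread al : (size (spread al) <= (r * M.-1 + J.-1).+1)%N.
Proof.
apply: (leq_trans (size_sum _ _ _)); apply/bigmax_leqP => i _.
apply: (leq_trans (size_sum _ _ _)); apply/bigmax_leqP => j _.
rewrite mul_polyC (leq_trans (size_scale_leq _ _)) // size_polyXn ltnS.
by rewrite leq_add ?leq_mul //; [have := ltn_ord i | have := ltn_ord j]; lia.
Qed.

Lemma size_twist : (size twist <= (2 * r).+1)%N.
Proof.
rewrite /twist (leq_trans (size_polyD _ _)) // geq_max size_trace_numerator //
  andbT.
by rewrite mul_polyC (leq_trans (size_scale_leq _ _)) // (@size_exp_degree _ _
  2).
Qed.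

Lemma size_constraint x : (0 < M)%N -> (0 < J)%N ->
  (size (constraint x) <= r * M.+1 + J)%N.
Proof.
move=> M0 J0; apply: (@leq_trans (r * M.-1 + J.-1 + 2 * r).+1); last first.
  by rewrite -(prednK M0) -(prednK J0) /= !mulnS; lia.
rewrite (leq_trans (size_polyD _ _)) // geq_max; apply/andP; split.
  apply: size_mul_degree; first exact: size_spread.
  by rewrite (leq_trans (@size_exp_degree _ _ 2 _ sB)) // ltnS leq_mul2l
    leq_subr orbT.
by apply: size_mul_degree; [exact: size_spread | exact: size_twist].
Qed.

(** Pigeonhole: [constraint] is additive, and the pairs of matrices outnumber
the polynomials in which it takes its values. *)
Lemma constraint_kernel : (r * M.+1 + J < 2 * (M * J))%N ->
  exists2 x, x != 0 & constraint x = 0.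
Proof.
move=> lt; have /andP[M0 J0] : (0 < M)%N && (0 < J)%N.
  by move: lt; clear; case: M => [|m]; case: J => [|j] //;
    rewrite ?muln0 ?mul0n ?muln0.
pose f x : 'rV[L]_(r * M.+1 + J) := poly_rV (constraint x).
have /injectivePn[x [y xy Efxy]] : ~~ injectiveb f.
  apply/negP => /injectiveP /leq_card; rewrite card_prod !card_mx -expnD mul1n.
  by rewrite leq_exp2l ?finNzRing_gt1 // leqNgt addnn -mul2n lt.
exists (x - y); first by rewrite subr_eq0.
have E : constraint x = constraint y.
  rewrite -[LHS](poly_rV_K (size_constraint x M0 J0)) -/(f x) Efxy /f.
  by rewrite poly_rV_K // size_constraint.
move: E; rewrite -[in LHS](subrK y x) /constraint !spreadD !mulrDl addrACA.
by move/(canRL (addrK _)); rewrite subrr.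
Qed.

End Auxiliary.

(** The bound is the degree of an auxiliary polynomial [G] that vanishes on the
whole set; the first condition makes it nonzero and the second makes it exist.
With [J] close to [r / 2] the bound is close to half of [#|L| = n * r]. *)
Lemma stepanov_bound M J eps : (2 * M + 3 <= n)%N ->
  (r * M.+1 + J < 2 * (M * J))%N ->
  (#|trace_set B D (k + l) eps| <= M + J.+1 * n)%N.
Proof.
move=> Mn lt; have [[al be] x0 Cx] := constraint_kernel eps lt.
pose G := collapse n (bipoly al) + collapse n (bipoly be) * trace_numerator B D
  k.
have G0 : G != 0.
  apply: contraNneq x0 => G0.
  have [] := trace_numerator_independent ch2 B0 sB sD Mn nonsplit _ _ G0.
  - exact: size_ordpoly.
  - exact: size_ordpoly.
  by move=> /bipoly_eq0-> /bipoly_eq0->.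
have sG : (size G <= (M + J.+1 * n).+1)%N.
  have n0 : (0 < n)%N by rewrite expn_gt0.
  have sc (c : 'M[L]_(M, J)) : (size (collapse n (bipoly c)) <= M.-1 + J.-1 * n
    + 1)%N.
    apply: size_collapse; first exact: size_ordpoly.
    move=> i; have [iM|Mi] := ltnP i M.
      by rewrite (coef_ordpoly _ (Ordinal iM)) size_ordpoly.
    by rewrite nth_default ?size_poly0 // (leq_trans (size_ordpoly _)).
  have /andP[M0 J0] : (0 < M)%N && (0 < J)%N.
    by move: lt; clear; case: M => [|m]; case: J => [|j] //;
      rewrite ?muln0 ?mul0n ?muln0.
  have hJ : (J.-1 * n + 2 * n = J.+1 * n)%N
    by rewrite -mulnDl -{2}(prednK J0); congr (_ * _)%N; lia.
  rewrite /G (leq_trans (size_polyD _ _)) // geq_max; apply/andP; split.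
    by apply: leq_trans (sc _) _; rewrite -hJ; clear; lia.
  apply: leq_trans (size_polyMleq _ _) _.
  have := size_trace_numerator k sB sD; have := sc be; rewrite -/n -hJ.
  move: (size (collapse _ _)) (size (trace_numerator _ _ _)) (J.-1 * n)%N => a
    b c.
  by move: M0; clear; lia.
rewrite -ltnS; apply: leq_trans sG; apply: card_roots_lt => // x.
rewrite inE => /andP[Bx /eqP Tx]; rewrite rootE.
have : G.[x] ^+ r * B.[x] ^+ (r - 1) = (constraint eps (al, be)).[x].
  move: (horner_collapse_bipoly al x) (horner_collapse_bipoly be x).
  rewrite /G; move: (collapse n (bipoly al)) (collapse n (bipoly be)) => a b.
  rewrite hornerD hornerM (exprD_pchar2 _ _ l ch2) exprMn => -> ->.
  rewrite horner_trace_numerator // /constraint /twist !hornerE /= mulrDl.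
  congr (_ + _); rewrite -!mulrA; congr (_ * _).
  rewrite horner_trace_numerator // exprMn -exprM -expnD -cardL expf_card.
  have -> : partial_trace k (D.[x] / B.[x] ^+ 2) ^+ (2 ^ l) =
      eps + partial_trace l (D.[x] / B.[x] ^+ 2).
    by apply: pchar2_eq => //; rewrite -Tx partial_traceD //;
      ring: (pchar2_2 ch2).
  have -> : B.[x] ^+ r = B.[x] * B.[x] ^+ (r - 1).
    by rewrite -exprS subn1 prednK // expn_gt0.
  by rewrite mulrAC mulrDr; congr (_ + _); rewrite mulrC.
rewrite Cx horner0 => /eqP; rewrite mulf_eq0 !expf_eq0 (negPf Bx) andbF orbF.
by case/andP.
Qed.

End Stepanov.

Section TraceFibres.
Variables (L : finFieldType) (K : closedFieldType) (iota : {rmorphism L -> K}).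
Hypothesis ch2 : (2 \in [pchar L])%N.
Variables (B D : {poly L}) (m : nat).
Hypotheses (B0 : B != 0) (sB : (size B <= 3)%N) (sD : (size D <= 5)%N).
Hypothesis nonsplit : forall s t : {poly K}, t != 0 ->
  s ^+ 2 * map_poly iota B ^+ 2 + s * t * map_poly iota B ^+ 2
    <> t ^+ 2 * map_poly iota D.
Hypothesis cardL : #|L| = (2 ^ m)%N.

(** With [n = 2 ^ k] and [r = 2 ^ l] for [k = uphalf m] and [l = m./2], the
choice [M = n / 4], [J = r / 2 + 4] meets both conditions of [stepanov_bound]
once [n >= 16]; below that the constant [12] makes the bound trivial. *)
Lemma card_trace_set_le eps :
  (2 * #|trace_set B D m eps| <= #|L| + 12 * 2 ^ uphalf m)%N.
Proof.
pose k := uphalf m; pose l := m./2; rewrite -/k.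
have Em : m = (k + l)%N by rewrite /k /l uphalf_half -addnA addnn
  odd_double_half.
have lk : (l <= k)%N by rewrite /l /k uphalf_half leq_addl.
have kl : (k <= l.+1)%N by rewrite /l /k uphalf_half; case: (odd m).
have triv : (#|trace_set B D m eps| <= #|L|)%N by apply: max_card.
have [k4|k4] := leqP k 3.
  have : (2 ^ l <= 2 ^ 3)%N by rewrite leq_exp2l // (leq_trans lk).
  move: triv; rewrite cardL Em expnD; move: #|_| (2 ^ k)%N (2 ^ l)%N => a b c.
  by clear; nia.
have l1 : (0 < l)%N by move: kl k4; clear; lia.
have En : (2 ^ k = 4 * 2 ^ (k - 2))%N
  by rewrite -(expnD 2 2) subnKC // ltnW // ltnW.
have Er : (2 ^ l = 2 * 2 ^ (l - 1))%N by rewrite -expnS subn1 prednK.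
have rn : (2 ^ l <= 2 ^ k)%N by rewrite leq_exp2l.
have n16 : (4 <= 2 ^ (k - 2))%N by rewrite (@leq_exp2l 2 2) //; move: k4;
  clear; lia.
have cL : #|L| = (2 ^ (k + l))%N by rewrite -Em.
have := @stepanov_bound _ _ _ ch2 _ _ _ _ B0 sB sD nonsplit cL (2 ^ (k - 2)) (2
  ^ (l - 1) + 4) eps.
rewrite -Em cardL Em expnD En Er.
move: En Er rn n16 => -> ->.
move: #|_| (2 ^ (k - 2))%N (2 ^ (l - 1))%N => z a b ba a4 H.
have Hz : (z <= a + (b + 5) * (4 * a))%N.
  rewrite -[(b + 5)%N]/(b + 4.+1)%N addnS; apply: H; first by clear -a4; lia.
  have -> : (2 * (a * (b + 4)) = 2 * b * a + 8 * a)%N by clear; lia.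
  by rewrite mulnS; clear -ba a4; lia.
have -> : (4 * a * (2 * b) = 8 * (a * b))%N by clear; lia.
have : ((b + 5) * (4 * a) = 4 * (a * b) + 20 * a)%N by clear; lia.
by clear -Hz; lia.
Qed.

(** The upper bound for trace [1] is a lower bound for trace [0]. *)
Lemma card_trace_set0_ge :
  (#|L| <= 2 * #|trace_set B D m 0%R| + 12 * 2 ^ uphalf m + 4)%N.
Proof.
have := card_trace_set_le 1; pose Z := [set x | root B x].
have sZ : (#|Z| <= 2)%N.
  rewrite -ltnS; apply: leq_trans sB; apply: card_roots_lt => // x.
  by rewrite inE.
have : (#|L| <= #|trace_set B D m 0%R| + #|trace_set B D m 1%R| + #|Z|)%N.
  have U : [set: L] \subset (trace_set B D m 0 :|: trace_set B D m 1) :|: Z.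
    apply/subsetP=> x _; rewrite !inE rootE -andb_orr.
    by rewrite (trace_eq0_or_eq1 ch2 cardL) andbT orNb.
  rewrite -cardsT; apply: leq_trans (subset_leq_card U) _.
  apply: leq_trans (leq_card_setU _ _) _; rewrite leq_add2r.
  exact: leq_card_setU.
move: sZ; move: #|L| #|Z| #|_| #|_| (2 ^ _)%N; clear; lia.
Qed.

End TraceFibres.

(** * Counting empty fibres *)

Section FibreCount.
Variables (L : finFieldType) (g h : {poly L}).
Hypothesis ch2 : (2 \in [pchar L])%N.
Hypotheses (cgh : coprimep g h) (dgh : rational_degree g h = 3%N).
Hypothesis cBW : coprimep (corrB g h) (corrW g h).
Hypothesis noinf : (pluecker g h 3 2 != 0) || (pluecker g h 3 1 != 0).


Local Notation A := (corrA g h).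
Local Notation B := (corrB g h).
Local Notation C := (corrC g h).
Local Notation W := (corrW g h).

Definition fibre (al : L) : {set L} := [set x | g.[x] == al * h.[x]].
Definition value_fibre (x : L) : {set L} := fibre (g.[x] / h.[x]).

Lemma fibre_denom al x : x \in fibre al -> h.[x] != 0.
Proof.
rewrite inE => /eqP gx; apply: contraTneq isT => hx.
by apply/negP=> _; apply: (coprime_no_common_root cgh _ hx);
  rewrite gx hx mulr0.
Qed.

Lemma mem_fibre al x : (x \in fibre al) = (h.[x] != 0) && (al == g.[x] / h.[x]).
Proof.
apply/idP/andP=> [xf|[hx /eqP->]]; last by rewrite inE divfK.
have hx := fibre_denom xf; split=> //; move: xf; rewrite inE => /eqP->.
by rewrite mulfK.
Qed.

Lemma card_fibre_le3 al : (#|fibre al| <= 3)%N.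
Proof.
rewrite -ltnS; have [sg sh] := rational_degree_sizes dgh.
have sp : (size (g - al *: h)%R <= 4)%N.
  rewrite (leq_trans (size_polyD _ _)) // geq_max sg size_polyN.
  by rewrite (leq_trans (size_scale_leq _ _)).
apply: leq_trans sp; apply: card_roots_lt => [|x]; last first.
  by rewrite inE rootE !hornerE subr_eq0.
rewrite subr_eq0; apply/negP => /eqP E.
have [] := coprime_scale_eq cgh dgh (u := al) (v := 1);
  first by rewrite scale1r E.
by move=> _ /eqP; rewrite oner_eq0.
Qed.

Lemma sum_fibres (f : L -> nat) :
  (\sum_al \sum_(x in fibre al) f al = \sum_(x | h.[x] != 0%R) f (g.[x] /
    h.[x])%R)%N.
Proof.
rewrite (exchange_big_dep (fun x => h.[x] != 0)) /=; last first.
  by move=> al x _; apply: fibre_denom.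
apply: eq_bigr => x hx; rewrite (eq_bigl (fun al => al == g.[x] / h.[x])).
  by rewrite big_pred1_eq.
by move=> al; rewrite mem_fibre hx.
Qed.

(** Discarding the zeros of [A] and [B] leaves genuine quadratic equations, and
discarding those of [W] leaves solutions off the diagonal. *)
Definition generic_point x := [&& h.[x] != 0, A.[x] != 0, B.[x] != 0 & W.[x] !=
  0].

Lemma card_value_fibre_generic m x : #|L| = (2 ^ m)%N -> generic_point x ->
  (#|value_fibre x|.-1 = 2 * (x \in trace_set B (A * C) m 0%R))%N.
Proof.
move=> cL /and4P[hx Ax Bx Wx].
rewrite inE Bx /= hornerM -(card_quadratic_roots ch2 cL _ Ax Bx).
have xv : x \in value_fibre x by rewrite mem_fibre hx eqxx.
rewrite (cardsD1 x) xv add1n /=; apply: eq_card => y; rewrite !inE.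
have -> : (g.[y] == g.[x] / h.[x] * h.[y]) =
    (g.[x] * h.[y] - g.[y] * h.[x] == 0).
  rewrite subr_eq0 eq_sym -(inj_eq (mulIf hx)).
  by rewrite mulrAC divfK.
rewrite (corrP dgh) mulf_eq0 subr_eq0 [x == y]eq_sym; case: eqP => //= ->.
by apply/esym/negbTE; rewrite -horner_corrW.
Qed.

Let corrB_neq0 : B != 0.
Proof.
apply: contraTneq noinf => B0; have := cBW; rewrite B0 coprime0p.
rewrite -size_poly_eq1 => /eqP sW;
  rewrite -(coef_corrW4 g h) nth_default ?sW // eqxx /=.
by have := coef_quadratic (pluecker g h 3 1) (pluecker g h 3 0 + pluecker g h 2
  1)
  (pluecker g h 2 0) 2; rewrite -/(corrB g h) B0 coef0 => /= <-; rewrite eqxx.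
Qed.

Let corrW_neq0 : W != 0.
Proof.
apply: contraTneq noinf => W0; have := cBW; rewrite W0 coprimep0.
rewrite -size_poly_eq1 => /eqP sB; rewrite -(coef_corrW4 g h) W0 coef0 eqxx /=.
have := coef_quadratic (pluecker g h 3 1) (pluecker g h 3 0 + pluecker g h 2 1)
  (pluecker g h 2 0) 2.
by rewrite -/(corrB g h) nth_default ?sB // => /= <-; rewrite eqxx.
Qed.

Let card_root_set (p : {poly L}) n : p != 0 -> (size p <= n.+1)%N ->
  (#|[set x | root p x]| <= n)%N.
Proof.
move=> p0 sp; rewrite -ltnS; apply: leq_trans sp; apply: card_roots_lt => // x.
by rewrite inE.
Qed.

Lemma card_nongeneric : (#|[set x | ~~ generic_point x]| <= 11)%N.
Proof.
pose rt (p : {poly L}) := [set x | root p x].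
have : [set x | ~~ generic_point x] \subset (rt h :|: rt A) :|: (rt B :|: rt W).
  by apply/subsetP=> x; rewrite !inE /generic_point !negb_and !negbK !rootE
    !orbA.
move/subset_leq_card => H; apply: leq_trans H _.
have h0 : h != 0.
  apply: contraTneq cgh => h0; rewrite h0 coprimep0 -size_poly_eq1.
  move: dgh; rewrite h0 /rational_degree /degree size_poly0 /= maxn0.
  by case: (size g) => [|[|?]].
have sW : (size W <= 5)%N.
  rewrite /corrW (leq_trans (size_polyD _ _)) // geq_max; apply/andP; split;
    last first.
    exact: leq_trans (size_corrC g h) _.
  rewrite (leq_trans (size_polyD _ _)) // geq_max; apply/andP; split.
    apply: (@size_mul_degree _ _ _ 2 2); first exact: size_corrA.
    by rewrite size_polyXn.
  apply: (@leq_trans 4) => //; apply: (@size_mul_degree _ _ _ 2 1).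
    exact: size_corrB.
  by rewrite size_polyX.
apply: leq_trans (leq_card_setU _ _) _.
apply: (@leq_add _ _ 5 6); apply: leq_trans (leq_card_setU _ _) _.
  apply: (@leq_add _ _ 3 2).
    by apply: card_root_set; case: (rational_degree_sizes dgh).
  by apply: card_root_set (corrA_neq0 cgh dgh) _; apply: size_corrA.
apply: (@leq_add _ _ 2 4); last exact: card_root_set.
by apply: card_root_set => //; apply: size_corrB.
Qed.

Lemma card_denom : (#|L| <= #|[set x | h.[x] != 0%R]| + 11)%N.
Proof.
rewrite -(cardsC [set x | h.[x] != 0]) leq_add2l;
  apply: leq_trans card_nongeneric.
apply: subset_leq_card; apply/subsetP=> x; rewrite !inE => hx.
by rewrite /generic_point negb_and hx.
Qed.

(** Fibre by fibre this is the identity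
[3 * (N == 0) + 3 * N = 3 + N * (N - 1) + (N == 2)] for [N <= 3]. *)
Lemma fibre_count_identity :
  (3 * #|[set al | fibre al == set0]| + 3 * #|[set x | h.[x] != 0%R]| =
   3 * #|L| + \sum_(x | h.[x] != 0%R) #|value_fibre x|.-1
   + #|[set al | #|fibre al| == 2]|)%N.
Proof.
have -> : #|[set x | h.[x] != 0%R]| = (\sum_al #|fibre al|)%N.
  have := sum_fibres (fun _ => 1%N).
  rewrite !sum1_card cardsE => <-; apply: eq_bigr => al _.
  by rewrite sum1_card.
rewrite -(sum_fibres (fun al => #|fibre al|.-1)).
have -> : #|L| = (\sum_(al : L) 1)%N by rewrite sum1_card.
rewrite -!sum1dep_card [X in (_ * X + _)%N]big_mkcond [X in (_ = _ +
  X)%N]big_mkcond /=.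
rewrite !big_distrr -!big_split /=; apply: eq_bigr => al _.
rewrite sum_nat_const -cards_eq0.
by have := card_fibre_le3 al; case: #|_| => [|[|[|[|]]]].
Qed.

Theorem card_empty_fibres m : #|L| = (2 ^ m)%N ->
  (3 * #|[set al | fibre al == set0]| <= #|L| + 100 * 2 ^ uphalf m)%N /\
  (#|L| <= 3 * #|[set al | fibre al == set0]| + 100 * 2 ^ uphalf m)%N.
Proof.
move=> cL; set N0 := #|[set al | _]|; set T := (2 ^ _)%N.
have T0 : (0 < T)%N by rewrite expn_gt0.
have q_good x : generic_point x -> (#|value_fibre x|.-1 = 2 * (x \in trace_set
  B (A * C) m 0%R))%N.
  exact: card_value_fibre_generic.
have q_le x : (#|value_fibre x|.-1 <= 2)%N
  by have := card_fibre_le3 (g.[x] / h.[x]); rewrite -/(value_fibre x); lia.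
have [K [iota _]] := countable_algebraic_closure L.
have sD : (size (A * C)%R <= 5)%N.
  by apply: (@size_mul_degree _ _ _ 2 2);
    [exact: size_corrA | exact: size_corrC].
have ns (s t : {poly K}) : t != 0 ->
    s ^+ 2 * map_poly iota B ^+ 2 + s * t * map_poly iota B ^+ 2
      <> t ^+ 2 * map_poly iota (A * C).
  move=> t0; rewrite rmorphM /= map_corrA map_corrB map_corrC.
  apply: corr_geometrically_nonsplit t0.
  - by rewrite (fmorph_pchar iota).
  - by rewrite coprimep_map.
  - by rewrite rational_degree_map.
  - by rewrite -map_corrB -map_corrW coprimep_map.
  - by rewrite !map_pluecker !fmorph_eq0.
have Zle := card_trace_set_le ch2 corrB_neq0 (size_corrB g h) sD ns cL 0.
have Zge := card_trace_set0_ge ch2 corrB_neq0 (size_corrB g h) sD ns cL.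
have bad := card_nongeneric; have den := card_denom;
  have id := fibre_count_identity.
have den_le : (#|[set x | h.[x] != 0%R]| <= #|L|)%N by apply: max_card.
set S := (\sum_(x | h.[x] != 0%R) _)%N in id.
set N2 := #|[set al | #|_| == 2]| in id.
set Z := #|trace_set _ _ _ _| in Zle Zge.
set bd := #|[set x | ~~ generic_point x]| in bad.
have Sle : (S <= 2 * Z + 2 * bd)%N.
  rewrite /S /Z /bd -!sum1dep_card !big_distrr /= big_mkcond [X in (_ <= X +
    _)%N]big_mkcond [X in (_ <= _ + X)%N]big_mkcond.
  rewrite -big_split /=; apply: leq_sum => x _; case: ifP => // _.
  have [gx|bx] := boolP (generic_point x); first by rewrite q_good // inE;
    case: ifP.
  by rewrite (leq_trans (q_le x)) // leq_addl.
have Sge : (2 * Z <= S + 2 * bd)%N.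
  rewrite /S /Z /bd -!sum1dep_card !big_distrr /= big_mkcond [X in (_ <= X +
    _)%N]big_mkcond [X in (_ <= _ + X)%N]big_mkcond.
  rewrite -big_split /=; apply: leq_sum => x _.
  have [gx|bx] := boolP (generic_point x); last by case: ifP; rewrite ?leq_addl.
  by have /and4P[-> _ _ _] := gx; rewrite q_good // inE; case: ifP.
(* A generic point has no or two companions in its fibre, never exactly one. *)
have N2le : (N2 <= bd)%N.
  rewrite /N2 /bd -!sum1dep_card.
  apply: (@leq_trans (\sum_al \sum_(x in fibre al) (#|fibre al| == 2))%N).
    rewrite big_mkcond; apply: leq_sum => al _; rewrite sum_nat_const.
    by case: eqP => // ->.
  rewrite (sum_fibres (fun al => nat_of_bool (#|fibre al| == 2))).
  rewrite big_mkcond [leqRHS]big_mkcond; apply: leq_sum => x _.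
  case: ifP => // _.
  have [/q_good|_] := boolP (generic_point x).
    rewrite /value_fibre => E; rewrite leqn0 eqb0; apply/eqP => E2; move: E.
    by rewrite E2; case: (x \in _).
  exact: leq_b1.
move: Zle Zge bad den id den_le Sle Sge N2le T0; rewrite -/T -/N0.
clearbody S N2 Z bd N0 T; move: #|L| #|[set x | h.[x] != 0]| => q d.
by clear; split; lia.
Qed.

End FibreCount.

(** * Irreducible polynomials and their roots *)

Section IrreducibleRoots.
Variable F : finFieldType.

Lemma irreducible_root_dvdp (E : fieldExtType F) (f p : {poly F}) (z : E) :
  irreducible_poly f -> root (map_poly (in_alg E) f) z ->
  root (map_poly (in_alg E) p) z -> f %| p.
Proof.
move=> irf fz pz; apply: contraLR isT; rewrite -irreducible_poly_coprime //.
rewrite -(coprimep_map (in_alg E)) => /coprimep_root/(_ fz) /negP[].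
by move: pz; rewrite rootE.
Qed.

Lemma adjoin_degree_root (E : fieldExtType F) (f : {poly F}) (z : E) :
  irreducible_poly f -> root (map_poly (in_alg E) f) z ->
  \dim <<1; z>>%VS = (size f).-1.
Proof.
move=> irf fz; rewrite dim_Fadjoin dimv1 muln1.
suff : size (minPoly 1 z) = size f by rewrite size_minPoly => <-.
have /polyOver1P[q Eq] := minPolyOver 1 z.
have fq : f %| q.
  by apply: irreducible_root_dvdp irf fz _; rewrite -Eq root_minPoly.
have : minPoly 1 z %| map_poly (in_alg E) f.
  by apply: minPoly_dvdp fz; apply/polyOver1P; exists f.
rewrite Eq dvdp_map size_map_poly => qf; apply: eqp_size.
by rewrite /eqp qf.
Qed.

(** The minimal polynomial, as a polynomial over [F]. *)
Lemma exists_irreducible_root (E : fieldExtType F) (z : E) :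
  exists2 f : {poly F}, irreducible_poly f &
    [/\ f \is monic, root (map_poly (in_alg E) f) z
      & (size f).-1 = \dim <<1; z>>%VS].
Proof.
have /polyOver1P[q Eq] := minPolyOver 1 z.
have qz : root (map_poly (in_alg E) q) z by rewrite -Eq root_minPoly.
have irq : irreducible_poly q.
  split; first by rewrite -(size_map_poly (in_alg E)) -Eq size_minPoly ltnS.
  move=> d sd dq; have := @minPoly_irr _ _ 1 z (map_poly (in_alg E) d).
  rewrite Eq dvdp_map dq eqp_map => /(_ _ isT) /orP[|//|].
  - by apply/polyOver1P; exists d.
  - by rewrite -(rmorph1 (map_poly (in_alg E))) eqp_map => /eqp_size;
    rewrite size_poly1 => s1; rewrite s1 in sd.
exists q => //; split=> //.
  by rewrite -(map_monic (in_alg E)) -Eq monic_minPoly.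
by rewrite -(adjoin_degree_root irq qz).
Qed.

(** Fermat's little theorem in the field obtained by adjoining one root of
[f]. *)
Lemma irreducible_dvd_XqX (f : {poly F}) :
  irreducible_poly f -> f %| 'X^(#|F| ^ (size f).-1) - 'X.
Proof.
move=> irf; have [E dE [z fz _]] := irredp_FAdjoin irf.
apply: irreducible_root_dvdp irf fz _.
rewrite rmorphB /= map_polyXn map_polyX rootE !hornerE subr_eq0 -dE.
by rewrite -Fermat's_little_theorem memvf.
Qed.

Lemma irreducible_factor (p : {poly F}) : (1 < size p)%N ->
  exists2 r, irreducible_poly r & r %| p.
Proof.
move: {2}(size p) (leqnn (size p)) => n; elim: n p => [|n IH] p.
  by rewrite leqn0 => /eqP->.
move=> sp p1; have [/irreducibleP irp|] := boolP (irreducibleb p).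
  by exists p.
rewrite /irreducibleb p1 /= => /forallPn[q];
  rewrite negb_imply -Pdiv.Idomain.dvdpE.
case/andP=> qp; rewrite -ltnNge => q1.
have [|r irr rq] := IH q _ q1.
  by apply: leq_trans (size_npoly q) _; rewrite -subn1 leq_subLR add1n.
by exists r => //; apply: dvdp_trans qp.
Qed.

End IrreducibleRoots.

Section RootsInExtension.
Variables (F : finFieldType) (L0 : fieldExtType F) (n : nat).
Local Notation L := (finvect_type L0).
Hypothesis dimL : \dim {:L} = n.

Lemma card_ext : #|L| = (#|F| ^ n)%N.
Proof. by rewrite -dimL -card_vspace -(card_vspacef (Vector.class L)). Qed.

(** [f] divides [X ^ #|L| - X], which is the product of the [X - x] over
[L]. *)
Lemma card_roots_ext (f : {poly F}) :
  irreducible_poly f -> (size f).-1 = n ->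
  #|[set x : L | root (map_poly (in_alg L) f) x]| = n.
Proof.
move=> irf sf; have := irreducible_dvd_XqX irf; rewrite sf.
rewrite -(dvdp_map (in_alg L)) rmorphB /= map_polyXn map_polyX -card_ext.
rewrite finField_genPoly -big_enum /= => /dvdp_prod_XsubC[m Em].
have := eqp_size Em; rewrite size_map_poly size_prod_XsubC => Esz.
have Us : uniq (mask m (enum L)) by rewrite mask_uniq ?enum_uniq.
rewrite -sf Esz /= -(card_uniqP Us); apply: eq_card => x.
by rewrite inE (eqp_root Em) root_prod_XsubC.
Qed.

End RootsInExtension.

(** The splitting field of [X ^ m - X], [m = q ^ n]: the [m] roots are the
fixed points of an iterated Frobenius automorphism, so they already form a
field. *)
Lemma finite_extension_exists (F : finFieldType) (n : nat) : (0 < n)%N ->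
  exists L : fieldExtType F, \dim {:L} = n.
Proof.
move=> n0; have q1 := finNzRing_gt1 F; pose m := (#|F| ^ n)%N.
have m1 : (1 < m)%N by rewrite /m (ltn_exp2l 0).
have m0 := ltnW m1; have m10 : (0 < m.-1)%N by rewrite -ltnS prednK.
pose q (R : nzRingType) : {poly R} := 'X^m - 'X.
have Dq (R : nzRingType) : q R = ('X^(m.-1) - 1) * ('X - 0).
  by rewrite subr0 mulrBl mul1r -exprSr prednK.
have q0 : q F != 0.
  by rewrite Dq monic_neq0 ?rpredM ?monicXsubC ?monicXnsubC.
have [L splitLq] := FinSplittingFieldFor q0.
exists L; have [/= a _ Da] := finField_galois_generator (sub1v {:L}%AS).
rewrite rmorphB rmorphXn /= map_polyX -/(q L) in splitLq.
have [zs DqL defL] := splitLq.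
have mL : m%:R = 0 :> L.
  have [p pr_p pchF] := finPcharP F.
  have pL : p \in [pchar L] by rewrite pchar_lalg.
  apply/eqP; rewrite -(dvdn_pcharf pL) /m Euclid_dvdX // n0 andbT.
  rewrite (card_pprimeChar pchF) dvdn_exp //.
  by rewrite -(ltn_exp2l 0 _ (prime_gt1 pr_p)) -card_pprimeChar.
have Uzs : uniq zs.
  rewrite -separable_prod_XsubC -(eqp_separable DqL) Dq separable_root andbC.
  rewrite /root !hornerE subr_eq0 eq_sym expr0n gtn_eqF ?oner_eq0 //=.
  rewrite cyclotomic.separable_Xn_sub_1 // -subn1 natrB // mL sub0r oppr_eq0.
  exact: oner_neq0.
have zsE z : (z \in zs) = (z ^+ m == z).
  by rewrite -root_prod_XsubC -(eqp_root DqL) /root !hornerE subr_eq0.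
have aX i x : (a ^+ i)%g x = x ^+ (#|F| ^ i).
  elim: i x => [|i IH] x; first by rewrite gal_id.
  rewrite expgSr galM ?memvf // IH Da ?memvf // dimv1 expn1.
  by rewrite -exprM expnSr.
have zsL z : z \in zs.
  have : z \in <<1 & zs>>%VS by rewrite defL memvf.
  rewrite zsE -aX => zL; apply/eqP/fixedSpaceP; move: z zL; apply/subvP.
  apply/Fadjoin_seqP; split; first exact: sub1v.
  by move=> x; rewrite zsE -aX => /eqP xs; apply/fixedSpaceP.
have cL : #|finvect_type L| = m.
  have sq : size (q L) = m.+1.
    by rewrite size_polyDl ?size_polyXn // size_polyN size_polyX.
  have := eqp_size DqL; rewrite -/(q L) sq size_prod_XsubC => -[->].
  by rewrite -(card_uniqP (Uzs : uniq (zs : seq (finvect_type L))));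
    apply: eq_card => z; rewrite zsL.
have : (#|F| ^ \dim {:finvect_type L})%N = m by rewrite -(card_ext (erefl _)).
by move/eqP; rewrite eqn_exp2l // => /eqP.
Qed.

Section SmallSubfields.
Variables (F : finFieldType) (L0 : fieldExtType F) (n : nat).
Local Notation L := (finvect_type L0).
Hypothesis dimL : \dim {:L} = n.

Lemma sum_powers_le q k : (1 < q)%N -> (\sum_(i < k) q ^ i.+1 <= 2 * q ^ k)%N.
Proof.
move=> q1; elim: k => [|k IH]; first by rewrite big_ord0.
rewrite big_ord_recr /= expnS; apply: leq_trans (leq_add IH (leqnn _)) _.
by rewrite -mulnDl mulnA leq_mul2r; apply/orP; right; move: q1; clear; lia.
Qed.

(** An element of degree [d < n] has [d] dividing [n], hence [d <= n / 2], and
is a root of [X ^ (q ^ d) - X]. *)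
Lemma card_nongenerators :
  (#|[set al : L | \dim <<1; al>>%VS != n]| <= 2 * #|F| ^ n./2)%N.
Proof.
apply: leq_trans (sum_powers_le _ (finNzRing_gt1 F)); rewrite -sum1dep_card.
pose fixedset i := [set x : L | root ('X^(#|F| ^ i.+1) - 'X) x].
apply: (@leq_trans (\sum_(x : L) \sum_(i < n./2) (x \in fixedset i))%N).
  rewrite big_mkcond; apply: leq_sum => x _; case: ifP => // dx.
  have dn : (\dim <<1; x>>%VS %| n)%N by rewrite -dimL;
    apply: field_dimS (subvf _).
  have d0 : (0 < \dim <<1; x>>%VS)%N by apply: adim_gt0.
  have n0 : (0 < n)%N by rewrite -dimL adim_gt0.
  have dh : ((\dim <<1; x>>%VS).-1 < n./2)%N.
    have /dvdnP[c Ec] := dn; rewrite prednK // -divn2 leq_divRL //.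
    case: c Ec => [|[|c]] Ec; first by move: n0; rewrite Ec.
      by move: dx; rewrite Ec mul1n eqxx.
    by rewrite Ec mulnC leq_mul2r orbT.
  rewrite (bigD1 (Ordinal dh)) //= inE rootE !hornerE prednK // subr_eq0.
  by rewrite -Fermat's_little_theorem memv_adjoin.
rewrite exchange_big; apply: leq_sum => i _ /=.
rewrite -big_mkcond sum1_card.
have q1 := finNzRing_gt1 F.
have sp : size ('X^(#|F| ^ i.+1) - 'X : {poly L}) = (#|F| ^ i.+1).+1.
  rewrite size_polyDl size_polyXn // size_polyN size_polyX ltnS.
  by rewrite (ltn_exp2l 0).
rewrite -ltnS -sp; apply: (@card_roots_lt _ _ (fixedset i)) => [|z].
  by rewrite -size_poly_eq0 sp.
by rewrite inE.
Qed.

End SmallSubfields.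

(** * From irreducible polynomials to empty fibres *)

Section ClearedSubst.

(** The homogeneous form of degree [n] attached to [f]: both the values and the
leading coefficient of [cleared_subst] are values of it. *)
Definition homogenized (E : fieldType) (n : nat) (f : {poly E}) (u v : E) : E :=
  \sum_(i < n.+1) f`_i * (u ^+ i * v ^+ (n - i)).

Lemma homogenizedE (E : fieldType) n (f : {poly E}) u v : (size f <= n.+1)%N ->
  v != 0 -> homogenized n f u v = v ^+ n * f.[u / v].
Proof.
move=> sf v0; rewrite /homogenized (horner_coef_wide _ sf) mulr_sumr.
apply: eq_bigr => i _; rewrite expr_div_n [RHS]mulrCA; congr (_ * _).
have le_in : (i <= n)%N by rewrite -ltnS.
rewrite -[X in _ = v ^+ X * _](subnK le_in) exprD mulrC -mulrA; congr (_ * _).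
by rewrite mulrCA mulfV ?mulr1 // expf_neq0.
Qed.

Lemma homogenized0 (E : fieldType) n (f : {poly E}) u :
  homogenized n f u 0 = f`_n * u ^+ n.
Proof.
rewrite /homogenized big_ord_recr /= subnn expr0 mulr1 big1 ?add0r // => i _.
by rewrite expr0n subn_eq0 leqNgt ltn_ord mulr0 mulr0.
Qed.

Lemma homogenized_eq0 (E : fieldType) n (f : {poly E}) u v :
  (0 < n)%N -> f \is monic -> size f = n.+1 -> (u != 0) || (v != 0) ->
  (homogenized n f u v == 0) = (v != 0) && root f (u / v).
Proof.
move=> n0 mf sf; have [->|v0] := eqVneq v 0.
  rewrite orbF /= homogenized0 => u0.
  have -> : f`_n = 1 by move: mf; rewrite monicE lead_coefE sf => /eqP.
  by rewrite mul1r expf_eq0 n0 (negPf u0).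
by move=> _; rewrite homogenizedE ?sf // mulf_eq0 expf_eq0 (negPf v0) andbF.
Qed.

Lemma horner_cleared_subst (F E : fieldType) (iota : {rmorphism F -> E})
    (g h f : {poly F}) n (x : E) :
  (map_poly iota (cleared_subst g h n f)).[x] =
  homogenized n (map_poly iota f) (map_poly iota g).[x] (map_poly iota h).[x].
Proof.
rewrite /cleared_subst rmorph_sum horner_sum; apply: eq_bigr => i _.
by rewrite /= map_polyZ hornerZ rmorphM !rmorphXn hornerM !horner_exp coef_map.
Qed.

Variables (F : fieldType) (g h : {poly F}).
Hypotheses (cgh : coprimep g h) (dgh : rational_degree g h = 3%N).
Let sg : (size g <= 4)%N. Proof. by case: (rational_degree_sizes dgh). Qed.
Let sh : (size h <= 4)%N. Proof. by case: (rational_degree_sizes dgh). Qed.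

Lemma horner_neq0_or (E : fieldType) (iota : {rmorphism F -> E}) (x : E) :
  ((map_poly iota g).[x] != 0) || ((map_poly iota h).[x] != 0).
Proof.
rewrite -negb_and; apply/negP => /andP[/eqP gx /eqP hx].
by apply: (@coprime_no_common_root _ (map_poly iota g) (map_poly iota h) _ x gx
  hx); rewrite coprimep_map.
Qed.

(** The coefficient of [X ^ (3 * n)] is the form [f] at the coefficients of
[X ^ 3] in [g] and [h]; it is nonzero because [f] has no root in [F]. *)
Lemma size_cleared_subst (n : nat) (f : {poly F}) : (1 < n)%N ->
  f \is monic -> size f = n.+1 -> irreducible_poly f ->
  size (cleared_subst g h n f) = (3 * n).+1.
Proof.
move=> n1 mf sf irf; set P := cleared_subst _ _ _ _.
have term (i : 'I_n.+1) : (size (g ^+ i * h ^+ (n - i))%R <= (3 * n).+1)%N.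
  have -> : (3 * n = 3 * i + 3 * (n - i))%N.
    by rewrite -mulnDr subnKC // -ltnS.
  by apply: size_mul_degree; apply: size_exp_degree.
have sP : (size P <= (3 * n).+1)%N.
  apply: (leq_trans (size_sum _ _ _)); apply/bigmax_leqP => i _.
  exact: leq_trans (size_scale_leq _ _) (term i).
apply/eqP; rewrite eqn_leq sP ltnNge; apply/negP => sP'.
have : P`_(3 * n) = 0 by rewrite nth_default.
rewrite coef_sum => /eqP; rewrite (_ : \sum_i _ = homogenized n f g`_3 h`_3).
  rewrite (homogenized_eq0 (ltnW n1) mf sf (top_coefs_neq0 dgh)).
  by rewrite (negPf (irreducible_no_root _ irf _)) ?andbF // sf.
apply: eq_bigr => i _; rewrite coefZ.
have -> : (3 * n = 3 * i + 3 * (n - i))%N by rewrite -mulnDr subnKC // -ltnS.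
by rewrite coefM_top ?size_exp_degree // !coefX_top.
Qed.

Lemma root_cleared_subst (E : fieldType) (iota : {rmorphism F -> E}) n f (x :
  E) :
  (0 < n)%N -> f \is monic -> size f = n.+1 ->
  root (map_poly iota (cleared_subst g h n f)) x =
  ((map_poly iota h).[x] != 0) &&
    root (map_poly iota f) ((map_poly iota g).[x] / (map_poly iota h).[x]).
Proof.
move=> n0 mf sf; rewrite rootE horner_cleared_subst homogenized_eq0 ?map_monic
  //.
  by rewrite size_map_poly.
exact: horner_neq0_or.
Qed.

End ClearedSubst.

Section Transform.
Variables (F : finFieldType) (L0 : fieldExtType F) (n : nat) (g h : {poly F}).
Local Notation L := (finvect_type L0).
Hypotheses (dimL : \dim {:L} = n) (n1 : (1 < n)%N).
Hypotheses (cgh : coprimep g h) (dgh : rational_degree g h = 3%N).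

Local Notation gL := (map_poly (in_alg L) g).
Local Notation hL := (map_poly (in_alg L) h).
Let cghL : coprimep gL hL. Proof. by rewrite coprimep_map. Qed.

Section OnePolynomial.
Variable f : {poly F}.
Hypotheses (mf : f \is monic) (sf : size f = n.+1) (irf : irreducible_poly f).

Let P := cleared_subst g h n f.
Let sP : size P = (3 * n).+1. Proof. exact: size_cleared_subst. Qed.

Lemma transformed_root_fibre (y : L) :
  root (map_poly (in_alg L) P) y ->
  exists2 al, root (map_poly (in_alg L) f) al & y \in fibre gL hL al.
Proof.
rewrite (root_cleared_subst cgh (in_alg L) _ (ltnW n1) mf sf) => /andP[hy fy].
by exists (gL.[y] / hL.[y]) => //; rewrite mem_fibre // hy eqxx.
Qed.

Lemma fibre_transformed_root (al y : L) :
  root (map_poly (in_alg L) f) al -> y \in fibre gL hL al ->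
  root (map_poly (in_alg L) P) y.
Proof.
rewrite mem_fibre // (root_cleared_subst cgh (in_alg L) _ (ltnW n1) mf sf).
by move=> fal /andP[-> /eqP <-].
Qed.

(** The field generated by a root [z] of [s] contains [g z / h z], a root of
[f]. *)
Lemma dvdn_degree_factor (s : {poly F}) :
  irreducible_poly s -> s %| P -> (n %| (size s).-1)%N.
Proof.
move=> irs sP'; have [E dE [z sz _]] := irredp_FAdjoin irs.
have : root (map_poly (in_alg E) P) z.
  by move: sP'; rewrite -(dvdp_map (in_alg E)) => /dvdpP[u ->];
    rewrite rootM sz orbT.
rewrite (root_cleared_subst cgh (in_alg E) _ (ltnW n1) mf sf) => /andP[_ fw].
rewrite -dE; have := adjoin_degree_root irf fw; rewrite sf /= => <-.
exact: field_dimS (subvf _).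
Qed.

(** The smaller of two complementary factors. *)
Lemma small_factor : ~~ irreducibleb P ->
  exists2 r, r %| P & (1 < size r)%N && (2 * (size r).-1 <= 3 * n)%N.
Proof.
have P0 : P != 0 by rewrite -size_poly_eq0 sP.
rewrite /irreducibleb sP /= ltnS muln_gt0 /= ltnW //= => /forallPn[q].
rewrite negb_imply -Pdiv.Idomain.dvdpE -ltnNge => /andP[qP q1].
have sq : (size q <= 3 * n)%N by apply: size_npoly.
case: (leqP (2 * (size q).-1) (3 * n)) => [q_small|q_big].
  by exists q; rewrite ?q1.
have [u Eu] := dvdpP _ _ qP; exists u; first by rewrite Eu dvdp_mulr.
have u0 : u != 0 by apply: contraNneq P0 => u0; rewrite Eu u0 mul0r.
have q0 : (q : {poly F}) != 0 by apply: contraNneq P0 => q0;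
  rewrite Eu q0 mulr0.
have := sP; rewrite Eu size_mul //; move: q1 sq q_big.
by move: (size u) (size (q : {poly F})) => a b; clear; lia.
Qed.

(** An irreducible factor of degree at most [3 * n / 2], being of degree
divisible by [n], has degree exactly [n], so its roots lie in [L]. *)
Lemma reducible_transformed_root : ~~ irreducibleb P ->
  exists y : L, root (map_poly (in_alg L) P) y.
Proof.
case/small_factor=> r rP /andP[r1 r_small].
have [s irs sr] := irreducible_factor r1; have sP' := dvdp_trans sr rP.
have r0 : r != 0 by rewrite -size_poly_gt0 ltnW.
have ssr := dvdp_leq r0 sr.
have s1 : (1 < size s)%N by case: irs.
have sn : (size s).-1 = n.
  have /dvdnP[c Ec] := dvdn_degree_factor irs sP'.
  case: c Ec => [|[|c]]; first by move: s1; case: (size s) => [|[|]].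
    by rewrite mul1n.
  move: r_small ssr r1 n1; case: (size s) s1 => // a _;
    case: (size r) => // b; clear.
  by rewrite /= ltnS => H1 H2 H3 H4 Ea; move: H2; rewrite Ea; nia.
have : (0 < #|[set x : L | root (map_poly (in_alg L) s) x]|)%N.
  by rewrite (card_roots_ext dimL irs sn) ltnW.
case/card_gt0P => y; rewrite inE => sy; exists y.
by move: sP'; rewrite -(dvdp_map (in_alg L)) => /dvdpP[u ->];
  rewrite rootM sy orbT.
Qed.

(** [P] has degree [3 * n], more than the degree [n] of any element of [L]. *)
Lemma irreducible_transformed_no_root (y : L) : irreducibleb P ->
  ~~ root (map_poly (in_alg L) P) y.
Proof.
move/irreducibleP=> irP; apply/negP => /(adjoin_degree_root irP).
rewrite sP /= => E; have := dimvS (subvf <<1; y>>%VS); rewrite E dimL.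
by move: n1; clear; lia.
Qed.

(** A point of the fibre above [al] is [t al] for some polynomial [t] over [F],
and the relation [g (t al) = al * h (t al)] passes to all conjugates of
[al]. *)
Lemma fibre_conjugate (al al' : L) :
  root (map_poly (in_alg L) f) al -> root (map_poly (in_alg L) f) al' ->
  fibre gL hL al != set0 -> fibre gL hL al' != set0.
Proof.
move=> fal fal' /set0Pn[y]; rewrite inE => /eqP yal.
have full : <<1; al>>%VS = {:L}%VS.
  apply/eqP; rewrite eqEdim subvf (adjoin_degree_root irf fal) sf dimL /=.
  exact: leqnn.
have : y \in <<1; al>>%VS by rewrite full memvf.
case/Fadjoin_polyP => _ /polyOver1P[t ->] Ey.
pose u := g \Po t - 'X * (h \Po t).
have uE (x : L) : (map_poly (in_alg L) u).[x] =
    gL.[(map_poly (in_alg L) t).[x]] - x * hL.[(map_poly (in_alg L) t).[x]].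
  rewrite /u rmorphB rmorphM /= map_polyX !map_comp_poly !hornerE.
  by rewrite !horner_comp.
have fu : f %| u.
  by apply: irreducible_root_dvdp irf fal _; rewrite rootE uE -Ey yal subrr.
apply/set0Pn; exists (map_poly (in_alg L) t).[al']; rewrite inE -subr_eq0 -uE.
move: fu; rewrite -(dvdp_map (in_alg L)) => /dvdpP[v ->].
by rewrite -rootE rootM fal' orbT.
Qed.

Lemma irreducible_transformed (al : L) : root (map_poly (in_alg L) f) al ->
  irreducibleb P = (fibre gL hL al == set0).
Proof.
move=> fal; apply/idP/idP => [irP|/eqP fib0].
  apply/negPn/negP => /set0Pn[y yf];
    move: (irreducible_transformed_no_root y irP).
  by rewrite (fibre_transformed_root fal yf).
apply/negPn/negP => /reducible_transformed_root[y /transformed_root_fibre[be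
  fbe ybe]].
have : fibre gL hL be != set0 by apply/set0Pn; exists y.
by move/(fibre_conjugate fbe fal); rewrite fib0 eqxx.
Qed.

End OnePolynomial.

(** Double count of the pairs formed by a polynomial of the set and a root. *)
Lemma card_transformed :
  (n * #|transformed_irreducibles g h n|)%N =
  #|[set al : L | (fibre gL hL al == set0) && (\dim <<1; al>>%VS == n)]|.
Proof.
pose I := transformed_irreducibles g h n.
have IP f : f \in I -> [/\ (f : {poly F}) \is monic, size (f : {poly F}) = n.+1
  ,
   irreducible_poly (f : {poly F}) & irreducibleb (cleared_subst g h n f)].
  by rewrite inE => /and4P[? /eqP ? /irreducibleP ? ?].
transitivity (\sum_(f in I) \sum_(al : L | root (map_poly (in_alg L) (f : {poly
  F})) al) 1)%N.
  rewrite mulnC -sum_nat_const; apply: eq_bigr => f /IP[mf sf irf _].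
  by rewrite sum1dep_card (card_roots_ext dimL) // sf.
rewrite (exchange_big_dep xpredT) //= -sum1dep_card [RHS]big_mkcond /=.
apply: eq_bigr => al _; case: ifP => [/andP[fib0 /eqP dal]|notal].
  have [f irf [mf fal sf]] := exists_irreducible_root al.
  have sfn : size f = n.+1.
    by rewrite -dal -sf prednK // size_poly_gt0 irredp_neq0.
  have sfn' : (size f <= n.+1)%N by rewrite sfn.
  rewrite (big_pred1 (NPoly sfn')) // => f' /=.
  apply/andP/eqP => [[/IP[mf' sf' irf' _] fal']|->].
    apply: val_inj => /=; apply/eqP; rewrite -eqp_monic //.
    by rewrite /eqp !(irreducible_root_dvdp (E := L) (z := al)).
  split=> //; rewrite inE /= mf sfn eqxx /=; apply/andP; split.
    exact/irreducibleP.
  by rewrite (irreducible_transformed mf sfn irf fal).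
rewrite big_pred0 // => f; apply/negbTE/negP => /andP[/IP[mf sf irf irP] fal].
move: notal; rewrite -(irreducible_transformed mf sf irf fal) irP /=.
by rewrite (adjoin_degree_root irf fal) sf eqxx.
Qed.

End Transform.

(** * The asymptotic count *)

Lemma sqrt_bound (R : realType) (q n e : nat) : q = (2 ^ e)%N ->
  ((2 ^ uphalf (e * n))%:R <= 2 * Num.sqrt (q%:R : R) ^+ n) /\
  ((q ^ n./2)%:R <= Num.sqrt (q%:R : R) ^+ n).
Proof.
move=> qe; set s := Num.sqrt _.
have q0 : (0 < q)%N by rewrite qe expn_gt0.
have s2 : s ^+ 2 = q%:R by rewrite sqr_sqrtr ?ler0n.
have s0 : 0 <= s by apply: sqrtr_ge0.
have sn2 : (s ^+ n) ^+ 2 = (q ^ n)%:R by rewrite -exprM mulnC exprM s2 natrX.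
have cmp (a b : R) : 0 <= a -> 0 <= b -> a ^+ 2 <= b ^+ 2 -> a <= b.
  by move=> a0 b0; rewrite ler_pXn2r.
split; apply: cmp; rewrite ?ler0n ?mulr_ge0 ?exprn_ge0 //.
  rewrite exprMn sn2 -!natrX -natrM ler_nat qe -!expnM -expnD leq_exp2l //.
  by rewrite muln2 uphalf_half; have := odd_double_half (e * n); case: odd; lia.
rewrite sn2 -natrX ler_nat -expnM leq_pexp2l // muln2.
by rewrite -{2}(odd_double_half n) leq_addl.
Qed.

Theorem theorem21 (R : realType) :
  exists C : R,
    forall (F : finFieldType) (K : closedFieldType)
           (iota : {rmorphism F -> K}) (g h : {poly F}),
      (2 \in [pchar F])%N ->
      is_algebraic_closure iota ->
      cubic_expression g h ->
      (forall P : option K,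
         cubic_ramification_point (map_poly iota g) (map_poly iota h) P ->
         ramification_index (map_poly iota g) (map_poly iota h) P <> 3%N) ->
      forall n : nat, (1 < n)%N ->
        `| #|transformed_irreducibles g h n|%:R
           - #|F|%:R ^+ n / (3 * n)%:R |
          <= C * (Num.sqrt (#|F|%:R : R) ^+ n / n%:R).
Proof.
(* [100] exceeds the [(2 * 100 + 6) / 3] that the estimates below give. *)
exists 100%:R => F K iota g h ch2 _ [cgh dgh] ram n n1.
have n0 := ltnW n1.
have chK : (2 \in [pchar K])%N by rewrite (fmorph_pchar iota).
have cghK : coprimep (map_poly iota g) (map_poly iota h)
  by rewrite coprimep_map.
have dghK : rational_degree (map_poly iota g) (map_poly iota h) = 3%N.
  by rewrite rational_degree_map.
have cBW : coprimep (corrB g h) (corrW g h).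
  rewrite -(coprimep_map iota) map_corrB map_corrW.
  exact: corrB_corrW_coprime chK cghK dghK ram.
have noinf : (pluecker g h 3 2 != 0) || (pluecker g h 3 1 != 0).
  rewrite -!(fmorph_eq0 iota) -!map_pluecker.
  exact: unramified_infinity dghK ram.
have [L0 dimL] := finite_extension_exists F n0.
pose L := finvect_type L0.
pose e := logn 2 #|F|; have qe : #|F| = (2 ^ e)%N by apply: card_pprimeChar ch2.
have cL : #|L| = (2 ^ (e * n))%N by rewrite (card_ext dimL) qe expnM.
have [] := @card_empty_fibres L (map_poly (in_alg L) g) (map_poly (in_alg L) h)
  _ _ _ _ _ _ cL.
- by rewrite (fmorph_pchar (in_alg L)).
- by rewrite coprimep_map.
- by rewrite rational_degree_map.
- by rewrite -map_corrB -map_corrW coprimep_map.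
- by rewrite !map_pluecker !fmorph_eq0.
set N0 := #|_| => Nub Nlb.
have small := card_nongenerators dimL.
have N := card_transformed dimL n1 cgh dgh.
have N_le : (n * #|transformed_irreducibles g h n| <= N0)%N.
  rewrite N; apply: subset_leq_card; apply/subsetP => x.
  by rewrite !inE => /andP[].
have N_ge : (N0 <= n * #|transformed_irreducibles g h n| + 2 * #|F| ^ n./2)%N.
  apply: leq_trans (leq_add (leqnn _) small); rewrite N.
  apply: leq_trans (leq_card_setU _ _); apply: subset_leq_card.
  by apply/subsetP => x; rewrite !inE => ->; case: eqP.
have [T_le S_le] := sqrt_bound R n qe.
rewrite (card_ext dimL) in Nub Nlb.
move: (#|transformed_irreducibles g h n|) N_le N_ge => x N_le N_ge.
have n3 : 0 < (3 * n)%:R :> R by rewrite ltr0n muln_gt0.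
have -> : x%:R - #|F|%:R ^+ n / (3 * n)%:R =
    ((3 * (n * x))%:R - (#|F| ^ n)%:R) / (3 * n)%:R :> R.
  rewrite natrX mulrBl; congr (_ - _);
    rewrite mulnA natrM mulrAC mulfV ?mul1r //.
  by rewrite gt_eqF.
rewrite normrM normfV (ger0_norm (ltW n3)) ler_pdivrMr //.
have -> : 100%:R * (Num.sqrt #|F|%:R ^+ n / n%:R) * (3 * n)%:R =
    300%:R * Num.sqrt #|F|%:R ^+ n :> R.
  by rewrite natrM; field; rewrite pnatr_eq0 -lt0n.
have S0 : 0 <= Num.sqrt (#|F|%:R : R) ^+ n by rewrite exprn_ge0 ?sqrtr_ge0.
move: (Num.sqrt _ ^+ n) S0 T_le S_le => S S0 T_le S_le.
have {}Nub : (3 * (n * x) <= #|F| ^ n + 100 * 2 ^ uphalf (e * n))%N.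
  by apply: leq_trans Nub; rewrite leq_mul2l N_le orbT.
have {}Nlb : (#|F| ^ n <= 3 * (n * x) + 6 * #|F| ^ n./2 + 100 * 2 ^ uphalf (e *
  n))%N.
  apply: leq_trans Nlb _; rewrite leq_add2r -[6%N]/(3 * 2)%N -(mulnA 3) -mulnDr.
  by rewrite leq_mul2l N_ge orbT.
have {}Nub : (3 * (n * x))%:R <=
    (#|F| ^ n)%:R + 100%:R * (2 ^ uphalf (e * n))%:R :> R.
  by rewrite -natrM -natrD ler_nat.
have {}Nlb : (#|F| ^ n)%:R <= (3 * (n * x))%:R + 6%:R * (#|F| ^ n./2)%:R
    + 100%:R * (2 ^ uphalf (e * n))%:R :> R.
  by rewrite -!natrM -!natrD ler_nat.
move: (3 * (n * x))%:R (#|F| ^ n)%:R (2 ^ uphalf (e * n))%:R Nub Nlb T_le.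
move: (#|F| ^ n./2)%:R S_le => u S_le y Q T Nub Nlb T_le.
by rewrite ler_norml; apply/andP; split; lra.
Qed.
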